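(* Let $a>r\geq 2$ be integers. Then $\varTheta(a,b)$ is $(r,1-\frac{1}{a})$-nice for all integers $b\geq 2$, and $\varTheta(a,b)$ is $r$-nice when $b=2$ or when $b$ is sufficiently large compared to $a$. Consequently, letting $\ell:=2+b(a-1)=|V(\varTheta(a,b))|$, for all $b\ge 2$ we have \[ f\left(n,r\ell,\binom{r\ell}{2}-(r-1)ab+1\right)=\Omega\left(n^{\frac{r}{r-1}\cdot\frac{a-1}{a}}\right). \]
   Context: For positive integers $p,q$ with $1\le q\le\binom p2$, a $(p,q)$-coloring of $K_n$ is an edge-coloring of $K_n$ in which every $p$ vertices span a clique with at least $q$ distinct colors; $f(n,p,q)$ is the minimum number of colors in a $(p,q)$-coloring of $K_n$. $\mathrm{ex}(n,F)$ is the Turán number of $F$. Asymptotics are in $n$ with all other parameters constant. For a bipartite graph $F$ and constants $r\ge 2$, $\alpha>0$, $F$ is called $(r,\alpha)$-nice if $\mathrm{ex}(n,F)=O(n^{2-\alpha})$ and \[ f\left(n,r|V(F)|,\binom{r|V(F)|}{2}-(r-1)|E(F)|+1\right)=\Omega\left(n^{\frac{\alpha r}{r-1}}\right); \] $F$ is $r$-nice if it is $(r,\alpha)$-nice for every $\alpha>0$ such that $\mathrm{ex}(n,F)=O(n^{2-\alpha})$. The theta graph $\varTheta(a,b)$ consists of $b$ internally vertex-disjoint paths, each with $a$ edges, sharing the same two endpoints (so $\varTheta(a,2)=C_{2a}$). *)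

(* Defs.v *)
From mathcomp Require Import all_boot all_order all_algebra.
From mathcomp Require Import all_classical all_reals all_analysis.

Set Implicit Arguments.
Unset Strict Implicit.
Unset Printing Implicit Defensive.

Import Order.TTheory GRing.Theory Num.Theory.
Import numFieldNormedType.Exports.

Local Open Scope nat_scope.

Definition edge (T : finType) := {e : {set T} | #|e| == 2}.

(* A simple graph on the vertex set T is its edge set, G : {set edge T}. *)

Definition bipartite (V : finType) (F : {set edge V}) :=
  [exists A : {set V}, forall e in F, #|val e :&: A| == 1].

(* The image of F under phi is a (not necessarily induced) subgraph of G. *)
Definition contains (V T : finType) (F : {set edge V}) (G : {set edge T}) :=
  [exists phi : {ffun V -> T},
    injectiveb phi && [forall e in F, exists g in G, val g == phi @: val e]].

(* The Turan number; F is assumed to have at least one edge, so that the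
   edgeless graph is F-free. *)
Definition turan (n : nat) (V : finType) (F : {set edge V}) : nat :=
  \max_(G : {set edge 'I_n} | ~~ contains F G) #|G|.

Definition pq_coloring (n p q k : nat) (c : {ffun edge 'I_n -> 'I_k}) :=
  [forall S : {set 'I_n}, (#|S| == p) ==>
    (q <= #|[set c e | e : edge 'I_n & val e \subset S]|)].

Definition pq_colorable (n p q k : nat) :=
  [exists c : {ffun edge 'I_n -> 'I_k}, pq_coloring p q c].

(* f(n, p, q).  When q <= 'C(p, 2) the rainbow coloring shows that the minimum
   exists; the value 0 is a default for larger q. *)
Definition pq_number (n p q : nat) : nat :=
  if pselect (exists k, pq_colorable n p q k) is left h then ex_minn h else 0.

Definition theta_vertex (a b : nat) : finType := (bool + 'I_b * 'I_a.-1)%type.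

(* The j-th vertex, 0 <= j <= a, of the i-th path: the common endpoints
   inl false and inl true are at j = 0 and j = a. *)
Definition theta_pt (a b : nat) (i : 'I_b) (j : nat) : theta_vertex a b :=
  if j == 0 then inl false
  else if insub j.-1 is Some k then inr (i, k) else inl true.

Definition theta (a b : nat) : {set edge (theta_vertex a b)} :=
  [set e | [exists i : 'I_b, exists j : 'I_a,
    val e == [set theta_pt a i j; theta_pt a i j.+1]]].

Local Open Scope ring_scope.
Local Open Scope classical_set_scope.

(* In the truncated subtraction, (r - 1) |E(F)| <= 'C(r |V(F)|, 2) because F is
   bipartite. *)
Definition nice_at (R : realType) (r : nat) (alpha : R)
    (V : finType) (F : {set edge V}) : Prop :=
  [/\ bipartite F, (2 <= r)%N, 0 < alpha,
      (fun n => (turan n F)%:R : R^o) =O_\oo (fun n => n%:R `^ (2 - alpha) : R^o)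
    & (fun n => (pq_number n (r * #|V|)
                   ('C(r * #|V|, 2) - (r - 1) * #|F| + 1))%:R : R^o)
        =Omega_\oo
      (fun n => n%:R `^ (alpha * r%:R / (r%:R - 1)) : R^o)].

Definition nice (R : realType) (r : nat) (V : finType) (F : {set edge V}) :
    Prop :=
  [/\ bipartite F, (2 <= r)%N
    & forall alpha : R, 0 < alpha ->
        (fun n => (turan n F)%:R : R^o) =O_\oo
          (fun n => n%:R `^ (2 - alpha) : R^o) ->
        nice_at r alpha F].

(* Main.v *)
(* Given a coloring with k colors, cut large matchings out of the color classes
   and form the graph on r-tuples of vertices whose adjacent tuples are joined
   coordinatewise by edges of one matching, a different block of the matching in
   each coordinate. This color energy graph has n^r vertices and on the order of
   n^(2r) / k^(r-1) edges, so it remains to bound its edges by ex(n^r, Theta).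
   Because of the matchings, an edge at a tuple is determined by its image in any
   one coordinate, and the coordinates of a leg of a theta graph are
   non-backtracking walks. If the tuples of a theta graph are such that
   in each coordinate |E| >= |V| + b - 2, then its at most r l vertices span too
   many edges for the number of colors; pendant tuples fill up the
   configuration to exactly the right number of vertices.
   For Theta(a, b') with b' large, b of the legs can be chosen with this
   property, and the Faudree-Simonovits bound ex(n, Theta(a, b')) = O(n^(1 + 1/a))
   gives the exponent 1 - 1/a. For b = 2 every cycle has the property. For b
   large, the coordinates in which a theta graph fails this identify its two
   endpoints and contain two legs without new colors, together with at most 2a
   others; deleting few neighbors at each tuple destroys all these, since otherwise
   they could be accumulated at one tuple until the surplus of edges over colors is
   contradictory. In the last two cases the bound holds with ex(n, Theta(a, b))
   itself, whence niceness for every alpha; a star shows that alpha <= 1. *)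

(* The coloring says that at most r ell vertices never carry (r - 1)ab more edges than colors. As ab
   = ell + b - 2, this can be tested in each coordinate: every color of a theta graph has an edge in
   every coordinate, so C <= E_j, and if V_j + b - 2 <= E_j for all j, then summing C + (r - 1)(V_j
   + b - 2) <= r E_j over j gives a forbidden surplus. The obstacle is that a theta graph has
   distinct tuples, not distinct coordinates: in one coordinate legs may overlap, and the two ends
   may coincide. Still, a leg that is not swallowed by earlier ones adds at most a edges, and fewer
   vertices than edges, so the ratio of new vertices to new edges is at most (a - 1)/a. This ratio
   dictates the weights of r(a - 1)(F - C) - (r - 1)aX, the quantity that is accumulated at one
   tuple. The condition r < a bounds the color degrees, and it gives the weight a - r its sign when
   the far end is new in a coordinate. *)
Require Import Defs.
From mathcomp Require Import all_boot all_order all_algebra zify.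
From mathcomp Require boolp.

Set Implicit Arguments.
Unset Strict Implicit.
Unset Printing Implicit Defensive.

(** * The Faudree-Simonovits bound *)

Section Degrees.
Variables (T : finType) (e : rel T).
Hypothesis e_sym : symmetric e.

Definition degree (A : {set T}) x := #|[set y in A | e x y]|.
Definition arcs (A : {set T}) := \sum_(x in A) degree A x.

Lemma degree_sum A x : degree A x = \sum_(y in A) e x y.
Proof.
rewrite /degree -sum1_card big_mkcond [RHS]big_mkcond /=.
by apply: eq_bigr => y _; rewrite inE; case: (y \in A); case: (e x y).
Qed.

Lemma arcs_del (A : {set T}) x : x \in A ->
  arcs A <= arcs (A :\ x) + (degree A x).*2.
Proof.
move=> Ax; rewrite /arcs (big_setD1 x Ax) /= -addnn addnC addnA leq_add2r.
have -> : \sum_(y in A :\ x) degree A y =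
          \sum_(y in A :\ x) degree (A :\ x) y + \sum_(y in A :\ x) e y x.
  rewrite -big_split /=; apply: eq_bigr => y _.
  by rewrite !degree_sum (big_setD1 x Ax) addnC.
rewrite leq_add2l degree_sum [X in _ <= X](big_setD1 x Ax) /=.
under eq_bigr => y _ do rewrite e_sym.
exact: leq_addl.
Qed.

(** Delete vertices of degree below [d] as long as there are any; by [arcs_del] each deletion costs
    at most [2d] arcs. *)
Lemma min_degree_subset d (A : {set T}) : exists W : {set T},
  [/\ W \subset A, forall x, x \in W -> d <= degree W x
    & arcs A + d.*2 * #|W| <= arcs W + d.*2 * #|A|].
Proof.
have [n] := ubnP #|A|; elim: n A => // n IH A ltAn.
case: (boolP [forall x in A, d <= degree A x]) => [/forall_inP H|].
  by exists A; split.
rewrite negb_forall_in => /exists_inP[x Ax]; rewrite -ltnNge => ltd.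
have cA : #|A| = (#|A :\ x|).+1 by rewrite (cardsD1 x A) Ax.
have [|W [sWA degW arcW]] := IH (A :\ x); first by rewrite cA in ltAn.
exists W; split => //; first exact: subset_trans sWA (subsetDl _ _).
have := arcs_del Ax; rewrite cA mulnS; nia.
Qed.

(** Greedy: each vertex put on the path joins the forbidden list [U], and [size U + s <= d] leaves a
    free neighbor at every step. *)
Lemma avoiding_path (W : {set T}) d v (U : seq T) s :
    (forall x, x \in W -> d <= degree W x) -> v \in W -> size U + s <= d ->
  exists p, [/\ size p = s, path e v p, all (mem W) p, uniq p
              & forall x, x \in p -> x \notin U].
Proof.
move=> degW; elim: s v U => [|s IH] v U Wv leUs; first by exists [::].
have : #|[set y in U]| < #|[set y in W | e v y]|.
  apply: leq_trans (degW v Wv); apply: leq_ltn_trans (_ : size U < _); last lia.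
  by rewrite cardsE card_size.
move=> ltc; have /set0Pn[y] : [set y in W | e v y] :\: [set y in U] != set0.
  apply: contraTneq ltc => /eqP; rewrite setD_eq0 => /subset_leq_card.
  by rewrite -leqNgt.
rewrite !inE => /and3P[Uy Wy evy].
have [|p [sp pp Wp up Up]] := IH y (y :: U) Wy; first by rewrite /=; lia.
exists (y :: p); split => /=; rewrite ?sp ?evy ?Wy ?up ?andbT //.
- by apply/negP => /Up; rewrite inE eqxx.
- move=> x; rewrite inE => /predU1P[->//|/Up]; rewrite inE negb_or.
  by case/andP.
Qed.

End Degrees.

Section Cut.
Variables (T : finType) (e : rel T).
Hypothesis e_irr : irreflexive e.

Definition cut_rel (B : {set T}) : rel T :=
  fun x y => e x y && ((x \in B) (+) (y \in B)).

(** Averaging over all [B]: toggling the membership of one end pairs the sets that cut a given edge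
    with those that do not. *)
Lemma cut_half : exists B, arcs e setT <= (arcs (cut_rel B) setT).*2.
Proof.
have flip (x y : T) : x != y ->
    (\sum_(B : {set T}) ((x \in B) (+) (y \in B))).*2 = #|{set T}|.
  move=> nxy; pose f (B : {set T}) := [set z | (z \in B) (+) (z == x)].
  have fK : involutive f.
    by move=> B; apply/setP=> z; rewrite !inE -addbA addbb addbF.
  rewrite -addnn {2}(reindex_inj (inv_inj fK)) /= -big_split /= -sum1_card.
  apply: eq_bigr => B _; rewrite !inE eqxx [y == x]eq_sym (negPf nxy).
  by case: (x \in B); case: (y \in B).
have tot : (\sum_(B : {set T}) arcs (cut_rel B) setT).*2
           = \sum_(B : {set T}) arcs e setT.
  rewrite sum_nat_const /arcs exchange_big -muln2 big_distrl big_distrr /=.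
  apply: eq_bigr => x _.
  under eq_bigr => B _ do rewrite degree_sum.
  rewrite exchange_big degree_sum big_distrl big_distrr /=.
  apply: eq_bigr => y _; rewrite muln2 /cut_rel.
  case: (boolP (e x y)) => [exy|_] /=; last by rewrite big1 // muln0.
  by rewrite muln1 flip //; apply: contraTneq exy => ->; rewrite e_irr.
case: (pickP (fun B => arcs e setT <= (arcs (cut_rel B) setT).*2)) => [B|no].
  by exists B.
have : \sum_(B : {set T}) arcs (cut_rel B) setT * 2
           < \sum_(B : {set T}) arcs e setT.
  rewrite (bigD1 set0) // [X in _ < X](bigD1 set0) //= -addSn.
  by apply: leq_add; last (apply: leq_sum => B _; apply: ltnW); rewrite muln2 ltnNge no.
by rewrite -tot -!muln2 big_distrl ltnn.
Qed.

End Cut.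

(* The interiors qs of internally disjoint paths with a edges from u to v. *)
Definition theta_legs (T : finType) (e : rel T) a u v (qs : seq (seq T)) :=
  all (fun q => (size q == a.-1) && path e u (rcons q v)) qs
  && uniq (u :: v :: flatten qs).

Definition edges_between (T : finType) (e : rel T) (X Y : {set T}) :=
  \sum_(y in Y) #|[set x in X | e x y]|.

Lemma edges_betweenC (T : finType) (e : rel T) (X Y : {set T}) :
  symmetric e -> edges_between e X Y = edges_between e Y X.
Proof.
move=> e_sym; rewrite /edges_between.
have H (A B : {set T}) :
    \sum_(y in A) #|[set x in B | e x y]| = \sum_(y in A) \sum_(x in B) e y x.
  by apply: eq_bigr => y _; rewrite -degree_sum; apply: eq_card => x;
     rewrite !inE e_sym.
rewrite !H exchange_big; apply: eq_bigr => x _; apply: eq_bigr => y _.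
by rewrite e_sym.
Qed.

(** * Consecutive levels of a tree in a theta-free graph span few edges *)

Section Levels.
Variables (T : finType) (e : rel T) (a b : nat).
Hypotheses (e_sym : symmetric e) (a_gt0 : 0 < a).
Hypothesis theta_free : forall u v qs, theta_legs e a u v qs -> size qs < b.
Variables (lev : T -> nat) (par : T -> T).
Hypothesis parP : forall x, 0 < lev x <= a ->
  e (par x) x /\ (lev (par x)).+1 = lev x.

Lemma lev_iter x t : lev x <= a -> t <= lev x ->
  lev (iter t par x) = lev x - t.
Proof.
move=> lexa; elim: t => [|t IH] let_; first by rewrite subn0.
have [|_] := parP (x := iter t par x); first by rewrite IH; lia.
by rewrite -iterS IH; lia.
Qed.

Lemma path_traject_par x m : lev x <= a -> m < lev x ->
  path e x (rcons (traject par (par x) m) (iter m par (par x))).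
Proof.
elim: m x => [|m IH] x lexa ltm /=.
  by rewrite e_sym; case: (parP (x := x)) => [|->]; rewrite ?andbT //; lia.
have [|ex lx] := parP (x := x); first lia.
rewrite e_sym ex -iterS iterSr; apply: IH; lia.
Qed.

Lemma uniq_traject_par x m : lev x <= a -> m <= lev x ->
  uniq (traject par x m.+1).
Proof.
move=> lexa lem; apply/(uniqP x) => s t; rewrite !inE size_traject => lts ltt.
rewrite !nth_traject // => /(congr1 lev); rewrite !lev_iter; lia.
Qed.

(** [mdeg] exceeds the number of vertices on fewer than [b] legs and a path in progress; [mbranch]
    allows for [a] ancestors of each of them. *)
Definition mdeg := b * a + a + 3.
Definition mbranch := a * (b * a + a + 3) + 1.

Section Diverse.
Variables (i m : nat) (z : T) (X Y : {set T}).
Hypotheses (ltia : i < a) (ltmi : m < i).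
Hypothesis XP : forall x, x \in X -> lev x = i /\ iter m.+1 par x = z.
Hypothesis YP : forall y, y \in Y -> lev y = i.+1.
Hypothesis diverse : forall y, y \in Y ->
  mbranch <= #|[set iter m par x | x in [set x in X | e x y]]|.

Let h : rel T := fun x y =>
  e x y && ((x \in X) && (y \in Y) || (x \in Y) && (y \in X)).

Let h_sym : symmetric h.
Proof.
by move=> x y; rewrite /h e_sym orbC ![(x \in _) && _]andbC.
Qed.

Let XY_disj x : x \in X -> x \in Y -> False.
Proof. by move=> /XP[+ _] /YP; lia. Qed.

Let arcs_h : (edges_between e X Y).*2 <= arcs h (X :|: Y).
Proof.
rewrite /arcs (big_setID Y) /= -addnn {2}(edges_betweenC _ _ e_sym).
have -> : (X :|: Y) :&: Y = Y by rewrite setIC setKU.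
have -> : (X :|: Y) :\: Y = X.
  apply/setP=> x; rewrite !inE; case Yx: (x \in Y); case Xx: (x \in X) => //.
  by case: (XY_disj Xx Yx).
apply: leq_add; apply: leq_sum => y y_in; apply: subset_leq_card;
  apply/subsetP => x; rewrite !inE /h e_sym y_in => /andP[-> ->];
  by rewrite ?orbT.
Qed.

Let path_side v p : path h v p ->
  (v \in (if odd (size p) then X else Y)) -> last v p \in Y.
Proof.
elim: p v => [|x p IH] v //= /andP[hvx /IH lastY] v_in; apply: lastY.
move: hvx v_in; rewrite /h => /andP[_].
by case: (odd _) => /= /orP[] /andP[] // vX vY // /XY_disj H; case: H.
Qed.

(** The new leg wanders inside [W] for [a - m - 2] steps, steps from [Y] into a branch of [z] not
    met before, and climbs the tree to [z] in [m + 1] steps. *)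
Lemma legs_extend (W : {set T}) v qs :
  W \subset X :|: Y -> (forall x, x \in W -> mdeg <= degree h W x) ->
  v \in W -> v \in (if odd (a.-1 - m.+1) then X else Y) -> size qs < b ->
  theta_legs e a v z qs -> exists q, theta_legs e a v z (q :: qs).
Proof.
move=> sWXY degW Wv v_in ltqb /andP[qsP uq].
have ltma : m.+1 < a := leq_ltn_trans ltmi ltia.
have sfl : size (flatten qs) = size qs * a.-1.
  rewrite size_flatten /shape; elim: (qs) qsP => //= q l IH /andP[].
  by case/andP=> /eqP-> _ /IH->.
pose U := v :: z :: flatten qs.
have sU : size U <= b * a by rewrite /= sfl; nia.
have [|p [sp pp Wp up Up]] := avoiding_path (e := h) (U := U)
  (s := a.-1 - m.+1) degW Wv; first by rewrite /mdeg; lia.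
have Yl : last v p \in Y by apply: path_side pp _; rewrite sp.
set y := last v p in Yl.
(* All ancestors, up to [m] steps, of the used vertices: if the climb from [x] met a used vertex,
   then [iter m par x] would be among them. *)
pose bad := [seq iter s par w | w <- U ++ p, s <- iota 0 m.+1].
have [x /andP[Xx exy] xbad] : exists2 x, (x \in X) && e x y &
    iter m par x \notin bad.
  have : #|[set w in bad]| < #|[set iter m par x | x in [set x in X | e x y]]|.
    apply: leq_trans (diverse Yl); rewrite cardsE.
    apply: leq_ltn_trans (card_size _) _; rewrite size_allpairs size_iota.
    move: sU; rewrite size_cat sp /mbranch; clear -ltma; nia.
  move=> ltc; have /set0Pn[w] :
      [set iter m par x | x in [set x in X | e x y]] :\: [set w in bad] != set0.
    apply: contraTneq ltc => /eqP; rewrite setD_eq0 => /subset_leq_card.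
    by rewrite -leqNgt.
  rewrite !inE => /andP[wbad /imsetP[x]]; rewrite inE => xP wE.
  by exists x => //; rewrite -wE.
have [lx zx] := XP Xx.
have tr_new w : w \in traject par x m.+1 -> w \notin U ++ p.
  case/trajectP=> s ltsm -> ; apply/negP => in_U; case/negP: xbad.
  have -> : iter m par x = iter (m - s) par (iter s par x).
    by rewrite -iterD subnK.
  by apply: allpairs_f => //; rewrite mem_iota; clear -ltsm; lia.
exists (p ++ traject par x m.+1); rewrite /theta_legs /= qsP andbT.
apply/andP; split.
  rewrite size_cat /= size_traject sp; apply/andP; split.
    by apply/eqP; clear -ltma; lia.
  rewrite rcons_cat cat_path /= e_sym -/y exy.
  rewrite -zx iterSr path_traject_par ?lx //; last by clear -ltmi ltia; lia.
  rewrite !andbT; apply: sub_path pp => ? ?; by case/andP.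
have ut : uniq (traject par x m.+1).
  by apply: uniq_traject_par; rewrite lx; clear -ltmi ltia; lia.
have upt : uniq (p ++ traject par x m.+1).
  rewrite cat_uniq up ut andbT; apply/hasPn => w /tr_new.
  by rewrite mem_cat negb_or => /andP[].
have : uniq ((p ++ traject par x m.+1) ++ U).
  rewrite cat_uniq upt uq andbT; apply/hasPn => w Uw; rewrite mem_cat negb_or.
  apply/andP; split; first by apply/negP => /Up; rewrite Uw.
  by apply/negP => /tr_new; rewrite mem_cat Uw.
rewrite uniq_catC => uU.
suff : uniq (v :: z :: flatten ((p ++ traject par x m.+1) :: qs)) by [].
rewrite -(perm_uniq (s1 := U ++ (p ++ traject par x m.+1))) //.
by rewrite /U !cat_cons !perm_cons perm_catC.
Qed.

(** Otherwise there is a subgraph of minimum degree [mdeg], in which legs from [v] to [z] can be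
    added one by one up to [b]. *)
Lemma diverse_sparse : edges_between e X Y <= mdeg * (#|X| + #|Y|).
Proof.
rewrite leqNgt; apply/negP => dense.
have [W [sWXY degW arcW]] := min_degree_subset h_sym mdeg (X :|: Y).
have arcW0 : 0 < arcs h W.
  have : #|X :|: Y| <= #|X| + #|Y| by rewrite cardsU leq_subr.
  by move: arcs_h arcW dense; rewrite -!muln2; nia.
(* The parity of the wandering part decides on which side [v] must lie for that part to end in [Y];
   an edge inside [W] offers both sides. *)
have [v Wv v_in] : exists2 v, v \in W &
    v \in (if odd (a.-1 - m.+1) then X else Y).
  move: arcW0; rewrite lt0n sum_nat_eq0 negb_forall_in => /exists_inP[x Wx].
  rewrite -lt0n => /card_gt0P[y]; rewrite inE /h => /andP[Wy /andP[_]].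
  by case: (odd _) => /orP[] /andP[]; first [by exists x | by exists y].
have lev_z x : x \in X -> lev z = i - m.+1.
  by case/XP=> lx <-; rewrite lev_iter lx //; lia.
have v_z : v != z.
  apply/eqP => vz; have vXY : v \in X :|: Y by move/subsetP: sWXY; apply.
  have lev_v : i <= lev v by move: vXY; rewrite inE => /orP[/XP[->]|/YP->].
  case/setUP: vXY (vXY) => [Xv|Yv] vXY.
    by have := lev_z _ Xv; rewrite -vz; lia.
  have lz : 0 < #|Y| by apply/card_gt0P; exists v.
  have /card_gt0P[w /imsetP[x]] : 0 < #|[set iter m par x | x in [set x in X | e x v]]|.
    by apply: leq_trans (diverse Yv); rewrite /mbranch; lia.
  rewrite inE => /andP[Xx _] _.
  by have := lev_z _ Xx; rewrite -vz; lia.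
have all_l l : l <= b -> exists2 qs, size qs = l & theta_legs e a v z qs.
  elim: l => [|l IH] leb; first by exists [::]; rewrite // /theta_legs /= inE v_z.
  have [qs sqs th] := IH (ltnW leb).
  have [|q thq] := legs_extend sWXY degW Wv v_in _ th; first by rewrite sqs.
  by exists (q :: qs) => //=; rewrite sqs.
have [qs sqs /theta_free] := all_l b (leqnn b).
by rewrite sqs ltnn.
Qed.

End Diverse.

Fixpoint level_const m :=
  if m is m'.+1 then mbranch * level_const m' + mdeg else 1.

Lemma edges_betweenU X (Y Z : {set T}) :
  edges_between e X (Y :|: Z) <= edges_between e X Y + edges_between e X Z.
Proof.
rewrite /edges_between (big_setID Y) /=; apply: leq_add.
  by rewrite setUK.
rewrite [X in _ <= X](big_setID (Z :\: Y)) /= setDUl setDv set0U.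
rewrite (_ : Z :&: (Z :\: Y) = Z :\: Y) ?leq_addr //.
by apply/setIidPr; apply: subsetDl.
Qed.

(* Induction on the height of the common ancestor z: either the vertices of Y
   see few branches at z, and one recurses into the branches, or many, and a
   dense subgraph yields a theta graph with z as an endpoint. *)
Lemma levels_sparse m i z (X Y : {set T}) : i < a -> m <= i ->
  (forall x, x \in X -> lev x = i /\ iter m par x = z) ->
  (forall y, y \in Y -> lev y = i.+1) ->
  edges_between e X Y <= level_const m * (#|X| + #|Y|).
Proof.
move=> ltia; elim: m z X Y => [|m IH] z X Y lemi XP YP.
  rewrite mul1n; apply: leq_trans (leq_addl _ _); rewrite -sum1_card.
  apply: leq_sum => y _; apply: (@leq_trans #|[set z]|); last by rewrite cards1.
  apply: subset_leq_card; apply/subsetP => x.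
  by rewrite !inE => /andP[/XP[_ /= ->]].
pose br y := [set iter m par x | x in [set x in X | e x y]].
pose Y1 := [set y in Y | #|br y| < mbranch].
pose Y2 := [set y in Y | mbranch <= #|br y|].
have YE : Y = Y1 :|: Y2.
  by apply/setP=> y; rewrite !inE -andb_orr ltnNge orNb andbT.
have cY : #|Y1| + #|Y2| = #|Y|.
  rewrite [in RHS]YE cardsU (_ : Y1 :&: Y2 = set0) ?cards0 ?subn0 //.
  by apply/setP=> y; rewrite !inE ltnNge; case: (mbranch <= _); rewrite ?andbF.
have leY2 : edges_between e X Y2 <= mdeg * (#|X| + #|Y2|).
  apply: (@diverse_sparse i m z) => // [y|y]; rewrite inE => /andP[] //.
  by move/YP.
(* Split by the branch [w] at [z]: the sets [Xb w] partition [X], and each vertex of [Y1] lies in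
   fewer than [mbranch] of the sets [Yb w]. *)
have leY1 : edges_between e X Y1 <= level_const m * (#|X| + mbranch * #|Y1|).
  pose Xb w := [set x in X | iter m par x == w].
  pose Yb w := [set y in Y1 | w \in br y].
  have -> : edges_between e X Y1 = \sum_w edges_between e (Xb w) (Yb w).
    rewrite /edges_between.
    have -> : \sum_(y in Y1) #|[set x in X | e x y]|
      = \sum_(y in Y1) \sum_w #|[set x in Xb w | e x y]|.
      apply: eq_bigr => y _; rewrite -sum1_card.
      rewrite (partition_big (iter m par) predT) //=; apply: eq_bigr => w _.
      rewrite -sum1_card; apply: eq_bigl => x; rewrite !inE.
      exact: andbAC.
    rewrite exchange_big; apply: eq_bigr => w _ /=.
    rewrite [LHS](bigID (fun y => w \in br y)) /= [X in _ + X]big1 ?addn0.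
      by apply: eq_bigl => y; rewrite !inE.
    move=> y /andP[_ nw]; apply: eq_card0 => x; rewrite !inE.
    apply/negP => /andP[/andP[Xx /eqP wE] exy]; case/negP: nw.
    by rewrite -wE; apply: imset_f; rewrite inE Xx.
  have -> : #|X| = \sum_w #|Xb w|.
    rewrite -sum1_card (partition_big (iter m par) predT) //=.
    by apply: eq_bigr => w _; rewrite -sum1_card; apply: eq_bigl => x;
       rewrite !inE.
  have leYb : \sum_w #|Yb w| <= mbranch * #|Y1|.
    rewrite mulnC -sum_nat_const.
    have -> : \sum_w #|Yb w| = \sum_(y in Y1) #|br y|.
      transitivity (\sum_w \sum_(y in Y1) (w \in br y)).
        apply: eq_bigr => w _; rewrite -sum1_card big_mkcond [RHS]big_mkcond.
        by apply: eq_bigr => y _; rewrite inE; case: (y \in Y1); case: (w \in _).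
      rewrite exchange_big; apply: eq_bigr => y _.
      by rewrite -sum1_card [RHS]big_mkcond; apply: eq_bigr => w _; case: (w \in _).
    by apply: leq_sum => y; rewrite inE => /andP[_ /ltnW].
  apply: leq_trans (_ : \sum_w level_const m * (#|Xb w| + #|Yb w|) <= _).
    apply: leq_sum => w _; apply: (IH w); first exact: ltnW.
      by move=> x; rewrite inE => /andP[/XP[-> _] /eqP].
    by move=> y; rewrite !inE => /andP[/andP[/YP]].
  by rewrite -big_distrr big_split /= leq_mul2l leq_add2l leYb orbT.
have := edges_betweenU X Y1 Y2; rewrite -YE /=.
have : 0 < mbranch by rewrite /mbranch addn1.
move: leY1 leY2; rewrite -cY; nia.
Qed.

End Levels.

Lemma theta_legs_sub (T : finType) (e e' : rel T) a u v qs :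
  subrel e e' -> theta_legs e a u v qs -> theta_legs e' a u v qs.
Proof.
move=> see' /andP[/allP legs uq]; rewrite /theta_legs uq andbT.
apply/allP => q /legs /andP[-> pq] /=; exact: sub_path pq.
Qed.

(** * Expansion of the layers around a vertex *)

Section Growth.
Variables (T : finType) (e : rel T) (a b d : nat) (x0 : T) (side : pred T).
Hypotheses (e_sym : symmetric e) (a_gt0 : 0 < a).
Hypothesis theta_free : forall u v qs, theta_legs e a u v qs -> size qs < b.
Hypothesis e_side : forall x y, e x y -> side x != side y.
Hypothesis deg_x0 : d <= degree e setT x0.
Hypothesis deg_nbr : forall x y, e x y -> d <= degree e setT y.

Fixpoint reach i : {set T} :=
  if i is i'.+1 then reach i' :|: [set y | [exists x in reach i', e x y]]
  else [set x0].

(** The distance from [x0], with the value [a.+1] for everything farther away than [a]. *)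
Definition level y := find (fun i => y \in reach i) (iota 0 a.+1).

Lemma reach_mono i j : i <= j -> reach i \subset reach j.
Proof.
move=> /subnK <-; elim: (j - i) => //= k IH.
exact: subset_trans IH (subsetUl _ _).
Qed.

Lemma level_le y i : i <= a -> (level y <= i) = (y \in reach i).
Proof.
move=> lei; apply/idP/idP => [lev_le|yi].
  have lts : has (fun i => y \in reach i) (iota 0 a.+1).
    by rewrite has_find size_iota ltnS (leq_trans lev_le).
  have := nth_find 0 lts; rewrite nth_iota ?add0n; last first.
    by rewrite ltnS (leq_trans lev_le).
  exact/subsetP/reach_mono.
rewrite leqNgt; apply/negP => /(before_find 0).
by rewrite nth_iota // yi.
Qed.

Lemma level0 x : level x = 0 -> x = x0.
Proof.
by move=> lx; apply/set1P; rewrite -[[set x0]]/(reach 0) -level_le ?lx.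
Qed.

Lemma level_step x y : e x y -> level x < a -> level y <= (level x).+1.
Proof.
move=> exy lta; rewrite level_le //= inE; apply/orP; right.
by rewrite inE; apply/exists_inP; exists x; rewrite // -level_le // ltnW.
Qed.

Definition parent y := odflt y [pick x | e x y && ((level x).+1 == level y)].

Lemma parentP y : 0 < level y <= a ->
  e (parent y) y /\ (level (parent y)).+1 = level y.
Proof.
move=> /andP[ly_gt0 ly_lea]; rewrite /parent.
case: pickP => [x /andP[exy /eqP]//|no] /=.
case ly: (level y) ly_gt0 ly_lea => [//|l] _ lea.
have : y \in reach l.+1 by rewrite -level_le ?ly.
rewrite /= inE -level_le ?ly ?ltnn; last exact: ltnW.
rewrite inE /= => /exists_inP[x xl exy]; have := no x; rewrite exy ly eqSS /=.
rewrite eqn_leq level_le ?(ltnW lea) // xl /= => /negbT; rewrite -ltnNge => ltl.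
by have := level_step exy (ltn_trans ltl lea); rewrite ly; lia.
Qed.

Lemma parent_root x i : level x = i -> i <= a -> iter i parent x = x0.
Proof.
move=> lx lea; apply: level0.
by rewrite (lev_iter (e := e) (a := a)) ?lx ?subnn //; apply: parentP.
Qed.

Lemma level_side x : level x <= a -> side x = side x0 (+) odd (level x).
Proof.
move lx: (level x) => i; elim: i x lx => [|i IH] x lx lea.
  by rewrite (level0 lx) addbF.
have [|ex lpx] := parentP (y := x); first by rewrite lx.
have := e_side ex; rewrite (IH (parent x)); last exact: ltnW.
  by rewrite /= addbN; case: (side x); case: (_ (+) _).
by apply/eqP; rewrite -eqSS lpx lx.
Qed.

Definition layer i := [set x | level x == i].

(** Adjacent vertices differ in [side], so no neighbor lies in the same layer. *)
Lemma layer_nbr i x : level x = i -> 0 < i < a ->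
  d <= #|[set y in layer i.-1 | e y x]| + #|[set y in layer i.+1 | e y x]|.
Proof.
move=> lx /andP[i_gt0 ltia].
have [|ex lpx] := parentP (y := x); first by rewrite lx i_gt0 ltnW.
apply: leq_trans (deg_nbr ex) _; apply: leq_trans (leq_card_setU _ _).
apply: subset_leq_card; apply/subsetP => y; rewrite !inE /= => exy.
have ly := level_step exy; rewrite lx in ly; have {ly} := ly ltia.
rewrite [e y x]e_sym exy !andbT => ly.
have lx' : i <= (level y).+1.
  by rewrite -lx; case: (ltnP (level y) a) => [|?]; last lia;
     apply: level_step; rewrite e_sym.
have : level y != i.
  apply/eqP => ly'; have := e_side exy.
  rewrite (level_side (x := x)) ?(level_side (x := y)) ?lx ?ly' ?eqxx //;
    exact: ltnW.
by move: ly lx'; lia.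
Qed.

Let c := level_const a b a.

Lemma level_const_mono m n : m <= n -> level_const a b m <= level_const a b n.
Proof.
move=> /subnK <-; elim: (n - m) => //= k IH.
by apply: leq_trans IH _; rewrite /mbranch; nia.
Qed.

Lemma layer_edges i : i < a ->
  edges_between e (layer i) (layer i.+1) <= c * (#|layer i| + #|layer i.+1|).
Proof.
move=> ltia.
have := levels_sparse e_sym a_gt0 theta_free parentP (m := i) (i := i)
  (z := x0) (X := layer i) (Y := layer i.+1) ltia (leqnn i).
move=> H; apply: leq_trans (H _ _) _.
- by move=> x; rewrite inE => /eqP lx; rewrite lx (parent_root lx) // ltnW.
- by move=> y; rewrite inE => /eqP.
by rewrite leq_mul2r level_const_mono ?orbT // ltnW.
Qed.

(** The edges at layer [i.+1], at least [d] for each vertex, all go to the two adjacent layers, and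
    [layer_edges] bounds both bundles. Since layer [i] is no larger, [d - 3c >= d / 2] times
    [#|layer i.+1|] is at most [c * #|layer i.+2|]. *)
Lemma layer_growth i : 6 * c <= d -> i < a ->
  d * #|layer i| <= 2 * c * #|layer i.+1| /\ #|layer i| <= #|layer i.+1|.
Proof.
move=> lecd.
have c_gt0 : 0 < c by have := @level_const_mono 0 a isT.
elim: i => [|i IH] ltia.
  have l0 : layer 0 \subset [set x0].
    by apply/subsetP => x; rewrite !inE => /eqP/level0 ->.
  have l1 : d <= #|layer 1|.
    apply: leq_trans deg_x0 _; apply: subset_leq_card; apply/subsetP => y.
    have lx0 : level x0 <= 0 by rewrite level_le // inE.
    rewrite !inE /= => exy.
    have := level_step exy; have -> : level x0 = 0 by lia.
    move=> /(_ a_gt0); rewrite leq_eqVlt => /orP[//|].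
    rewrite ltnS leqn0 => /eqP/level0 y0; have := e_side exy.
    by rewrite y0 eqxx.
  have := subset_leq_card l0; rewrite cards1; nia.
have [IH1 IH2] := IH (ltnW ltia).
have : d * #|layer i.+1| <= edges_between e (layer i) (layer i.+1) +
                           edges_between e (layer i.+1) (layer i.+2).
  rewrite [X in _ + X]edges_betweenC // -big_split /= mulnC -sum_nat_const.
  apply: leq_sum => x; rewrite inE => /eqP lx.
  exact: (layer_nbr lx).
have := layer_edges (ltnW ltia); have := layer_edges ltia; nia.
Qed.

(** Growth gives the factor [2c]; the larger [6c] makes the bound trivial when [d] is too small for
    [layer_growth]. *)
Lemma growth_bound : d ^ a <= (6 * c) ^ a * #|T|.
Proof.
have T_gt0 : 0 < #|T| by apply/card_gt0P; exists x0.
case: (leqP (6 * c) d) => [lecd|/ltnW ltdc]; last first.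
  by apply: leq_trans (leq_pmulr _ T_gt0); rewrite leq_exp2r.
have H i : i <= a -> d ^ i <= (2 * c) ^ i * #|layer i|.
  elim: i => [|i IH] lei.
    rewrite mul1n card_gt0; apply/set0Pn; exists x0.
    by rewrite inE -leqn0 level_le // inE.
  have [] := layer_growth lecd lei; have := IH (ltnW lei).
  rewrite !expnS => h1 h2 _; nia.
apply: leq_trans (H a (leqnn a)) _; apply: leq_mul; last exact: max_card.
by rewrite leq_exp2r // leq_mul2r orbT.
Qed.

End Growth.

(* The Faudree-Simonovits theorem, for the number of ordered adjacent pairs. *)
Theorem theta_free_arcs a b : 0 < a -> exists C, forall (T : finType) (e : rel T),
  symmetric e -> irreflexive e ->
  (forall u v qs, theta_legs e a u v qs -> size qs < b) ->
  arcs e setT ^ a <= C * #|T| ^ a.+1.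
Proof.
move=> a_gt0; pose c := (6 * level_const a b a) ^ a.
exists (16 ^ a * (c + 1)) => T e e_sym e_irr free.
have [B leB] := cut_half e_irr; pose g := cut_rel e B.
have g_sym : symmetric g by move=> x y; rewrite /g /cut_rel e_sym addbC.
have [->|arc_gt0] := posnP (arcs e setT); first by rewrite exp0n.
have arcg_gt0 : 0 < arcs g setT by move: leB; rewrite -/g -muln2; nia.
have T_gt0 : 0 < #|T|.
  rewrite lt0n -cardsT cards_eq0; apply: contraTneq arc_gt0 => ->.
  by rewrite /arcs big_set0.
(* A quarter of the average degree of [g]: deleting vertices of degree below [d] costs at most half
   of the arcs, so [W] is nonempty. *)
pose d := arcs g setT %/ (4 * #|T|).
have dle : d * (4 * #|T|) <= arcs g setT by apply: leq_trunc_div.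
have dgt : arcs g setT < d.+1 * (4 * #|T|) by apply: ltn_ceil; rewrite muln_gt0.
have [W [_ degW arcW]] := min_degree_subset g_sym d setT.
rewrite cardsT -!muln2 in arcW.
have /set0Pn[x0 Wx0] : W != set0.
  apply: contraTneq arcW => ->.
  by rewrite [arcs g set0]/arcs big_set0 cards0 -ltnNge; nia.
pose h x y := [&& g x y, x \in W & y \in W].
have degh x : x \in W -> d <= degree h setT x.
  move=> Wx; apply: leq_trans (degW x Wx) _; apply: subset_leq_card.
  by apply/subsetP => y; rewrite !inE /h Wx /= andbC.
have ledd : d ^ a <= c * #|T|.
  apply: (@growth_bound T h a b d x0 (mem B)) => //.
  - by move=> x y; rewrite /h g_sym [(x \in W) && _]andbC.
  - move=> u v qs th; apply: (free u v); apply: theta_legs_sub th.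
    by move=> x y /and3P[/andP[]].
  - by move=> x y /and3P[/andP[_]] /=; case: (x \in B); case: (y \in B).
  - exact: degh.
  - by move=> x y /and3P[_ _]; apply: degh.
(* [maxn 1 d] covers [d = 0], where [e] has fewer than [8 * #|T|] arcs. *)
have le1 : arcs e setT <= 16 * #|T| * maxn 1 d by move: leB; rewrite -/g -muln2; nia.
apply: (@leq_trans ((16 * #|T| * maxn 1 d) ^ a)); first by rewrite leq_exp2r.
rewrite !expnMn -mulnA -mulnA leq_mul2l; apply/orP; right.
rewrite expnSr mulnCA leq_mul2l; apply/orP; right.
rewrite mulnDl mul1n; case: (leqP 1 d) => _; first exact: leq_trans ledd (leq_addr _ _).
by rewrite exp1n; apply: leq_trans (leq_addl _ _).
Qed.

(** * Counting vertices and edges of walks *)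

Lemma cardsUD (U : finType) (A B : {set U}) : #|A :|: B| = #|A| + #|B :\: A|.
Proof.
rewrite cardsU cardsD [B :&: A]setIC; have := subset_leq_card (subsetIr A B).
lia.
Qed.

Lemma mem_bigcup_seq (I : eqType) (U : finType) (F : I -> {set U}) s x :
  reflect (exists2 i, i \in s & x \in F i) (x \in \bigcup_(i <- s) F i).
Proof.
apply: (iffP idP) => [|[i si xi]].
  elim: s => [|i s IH]; rewrite ?big_nil ?inE // big_cons inE.
  case/orP => [xi|/IH[j sj xj]]; first by exists i; rewrite // mem_head.
  by exists j; rewrite // inE sj orbT.
elim: s si => // j s IH; rewrite inE big_cons inE.
by case/predU1P => [<-|/IH->]; rewrite ?xi ?orbT.
Qed.

(* lia identifies cardinals of sets of sets only up to syntax *)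
Ltac slia := unfold reverse_coercion in *; simpl in *; nia.

Section Walks.
Variables (V : finType) (a : nat).
Implicit Types (w : nat -> V) (X : {set V}) (F E : {set {set V}}).

Definition walk_edges w : {set {set V}} :=
  [set [set w (val s); w (val s).+1] | s : 'I_a].
Definition walk_verts w := [set w (val s) | s : 'I_a.+1].
Definition non_backtracking w :=
  (forall s, s < a -> w s != w s.+1) /\ (forall s, s.+1 < a -> w s != w s.+2).

Lemma walk_edge w s : s < a -> [set w s; w s.+1] \in walk_edges w.
Proof. by move=> lts; apply/imsetP; exists (Ordinal lts). Qed.

Lemma walk_edgeP w f :
  reflect (exists2 s, s < a & f = [set w s; w s.+1]) (f \in walk_edges w).
Proof.
apply: (iffP imsetP) => [[s _ ->]|[s lts ->]]; first by exists s.
by exists (Ordinal lts).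
Qed.

Lemma walk_vertP w z :
  reflect (exists2 s, s <= a & z = w s) (z \in walk_verts w).
Proof.
apply: (iffP imsetP) => [[s _ ->]|[s les ->]].
  by exists s => //; rewrite -ltnS.
by exists (Ordinal (les : s < a.+1)).
Qed.

Lemma card_walk_edges w : #|walk_edges w| <= a.
Proof. by rewrite -[X in _ <= X]card_ord; apply: leq_imset_card. Qed.

Lemma handshake E (Z : {set V}) : (forall f, f \in E -> #|f| = 2) ->
  \sum_(z in Z) #|[set f in E | z \in f]| <= 2 * #|E|.
Proof.
move=> E2.
have -> : \sum_(z in Z) #|[set f in E | z \in f]|
        = \sum_(f in E) \sum_(z in Z) (z \in f).
  rewrite exchange_big; apply: eq_bigr => z _ /=.
  rewrite -sum1_card big_mkcond [RHS]big_mkcond; apply: eq_bigr => f _ /=.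
  by rewrite inE; case: (f \in E); case: (z \in f).
rewrite mulnC -sum_nat_const; apply: leq_sum => f /E2 <-.
rewrite -sum1_card [X in _ <= X]big_mkcond [X in X <= _]big_mkcond.
by apply: leq_sum => z _; case: (z \in Z); case: (z \in f).
Qed.

Lemma walk_edge_card w f : non_backtracking w -> f \in walk_edges w -> #|f| = 2.
Proof. by move=> [nb _] /walk_edgeP[s lts ->]; rewrite cards2 nb. Qed.

Lemma interior_degree w E s : non_backtracking w -> 0 < s < a ->
  (forall f, f \in walk_edges w -> w s \in f -> f \in E) ->
  2 <= #|[set f in E | w s \in f]|.
Proof.
move=> [nb1 nb2] /andP[s_gt0 lts] inE'.
case: s s_gt0 lts inE' => // s _ lts H.
have : [set [set w s; w s.+1]; [set w s.+1; w s.+2]]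
         \subset [set f in E | w s.+1 \in f].
  apply/subsetP => f /set2P[]->; rewrite inE H ?walk_edge ?(ltnW lts) //;
  by rewrite !inE eqxx ?orbT.
move/subset_leq_card; apply: leq_trans; rewrite cards2.
have -> // : [set w s; w s.+1] != [set w s.+1; w s.+2].
apply/eqP => /setP/(_ (w s)); rewrite !inE eqxx.
by rewrite (negPf (nb1 _ _)) ?(negPf (nb2 _ _)) // ltnW.
Qed.

Definition supported X F := forall f, f \in F -> f \subset X.

(** Count incidences with new edges. A new vertex is interior to the walk and all edges at it are
    new, at least two; the start of the first new edge lies in [X] and adds one more. So twice the
    new vertices, plus one, is at most twice the new edges. *)
Lemma walk_gain w X F : 0 < a -> non_backtracking w -> supported X F ->
    w 0 \in X -> w a \in X ->
  if walk_edges w \subset F then walk_verts w \subset X else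
  #|walk_verts w :\: X| < #|walk_edges w :\: F|.
Proof.
move=> a_gt0 nb FX w0 wa; case: ifP => [EF|].
  apply/subsetP => z /walk_vertP[s les ->].
  case: (ltngtP s a) les => // [lts _|-> //].
  have /FX/subsetP := subsetP EF _ (walk_edge w lts).
  by apply; rewrite !inE eqxx.
move/negbT/subsetPn => [f0 /walk_edgeP[s0 lts0 f0E] f0F].
have [s [lts sF sX]] : exists s,
    [/\ s < a, [set w s; w s.+1] \notin F & w s \in X].
  have : exists s, (s < a) && ([set w s; w s.+1] \notin F).
    by exists s0; rewrite lts0 -f0E.
  move/ex_minnP => [s /andP[lts sF] smin]; exists s; split => //.
  case: s lts sF smin => // s lts _ smin.
  have sF : [set w s; w s.+1] \in F.
    have := smin s; rewrite (ltnW lts) ltnn /=.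
    by case: (_ \in F) => //= /(_ isT).
  by apply: (subsetP (FX _ sF)); rewrite !inE eqxx orbT.
set T := _ :\: X; set E := _ :\: F.
have := @handshake E (w s |: T).
have E2 f : f \in E -> #|f| = 2 by rewrite inE => /andP[_ /walk_edge_card->].
move=> /(_ E2); have wsT : w s \notin T by rewrite inE sX.
rewrite (big_setU1 _ wsT) /= => H.
have h1 : 0 < #|[set f in E | w s \in f]|.
  apply/card_gt0P; exists [set w s; w s.+1].
  by rewrite !inE sF walk_edge // eqxx.
have h2 : 2 * #|T| <= \sum_(z in T) #|[set f in E | z \in f]|.
  rewrite mulnC -sum_nat_const; apply: leq_sum => z.
  rewrite inE => /andP[zX /walk_vertP[t let_ zE]].
  rewrite zE in zX *; apply: interior_degree => //.
    by rewrite lt0n ltn_neqAle let_ andbT; apply/andP; split;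
      apply: contraNneq zX => ->.
  move=> f fE wf; rewrite inE fE andbT; apply: contra zX => /FX/subsetP.
  exact.
by have := leq_trans (leq_add h1 h2) H; lia.
Qed.

(** New vertices occur only at the [a - 1] interior positions, so each of these must hold one. *)
Lemma full_walk_interior w X s : w 0 \in X -> w a \in X ->
  a.-1 <= #|walk_verts w :\: X| -> 0 < s < a -> w s \notin X.
Proof.
move=> w0 wa le_a /andP[s_gt0 lts]; apply/negP => ws.
have : walk_verts w :\: X \subset
    [set w (val t) | t in [set~ inord s : 'I_a.+1] :\ ord0 :\ ord_max].
  apply/subsetP => z; rewrite inE => /andP[zX /walk_vertP[t let_ zE]].
  apply/imsetP; exists (inord t); last by rewrite /= inordK ?ltnS.
  rewrite !inE; have := zX; rewrite zE => tX.
  apply/and3P; split; apply: contraNneq tX => /(congr1 val) /=;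
    by rewrite /= ?inordK ?ltnS // ?(ltnW lts) // => ->.
move/subset_leq_card/leq_trans => /(_ _ (leq_imset_card _ _)) le_c.
have {}le_c : #|walk_verts w :\: X| <=
    #|[set~ inord s : 'I_a.+1] :\ ord0 :\ ord_max| by exact: le_c.
have := cardsD1 ord0 [set~ inord s : 'I_a.+1].
have := cardsD1 ord_max ([set~ inord s : 'I_a.+1] :\ ord0).
rewrite cardsC1 card_ord !inE -!val_eqE /= inordK; last exact: ltnW.
have -> : a != 0 by lia.
have -> : a != s by lia.
have -> : 0 != s by lia.
by move: le_a le_c => /=; lia.
Qed.

(** * Families of walks, added one after another *)

Section Families.
Variables (I : eqType) (w : I -> nat -> V).
Implicit Types (s : seq I).
Hypothesis a_gt0 : 0 < a.

Definition verts_of s := \bigcup_(i <- s) walk_verts (w i).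
Definition edges_of s : {set {set V}} := \bigcup_(i <- s) walk_edges (w i).

Lemma edges_ofP s f :
  reflect (exists2 i, i \in s & f \in walk_edges (w i)) (f \in edges_of s).
Proof. exact: mem_bigcup_seq. Qed.

Lemma verts_ofP s z :
  reflect (exists2 i, i \in s & z \in walk_verts (w i)) (z \in verts_of s).
Proof. exact: mem_bigcup_seq. Qed.

Lemma supportedU s X F : supported X F ->
  supported (X :|: verts_of s) (F :|: edges_of s).
Proof.
move=> FX f /setUP[/FX fX|/edges_ofP[i si /walk_edgeP[t lta ->]]].
  exact: subset_trans fX (subsetUl _ _).
apply/subsetP => z /set2P[]->; rewrite inE; apply/orP; right;
  by apply/verts_ofP; exists i => //; apply/walk_vertP; eexists; last reflexivity;
     rewrite // ltnW.
Qed.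

Fixpoint redundant F s := if s is i :: s' then
  (walk_edges (w i) \subset F) + redundant (F :|: walk_edges (w i)) s' else 0.

(** A redundant walk is covered by [F] and the walks before it, and dropping the redundant ones
    among these loses no edges. *)
Lemma redundant_cover F s : uniq s -> exists D, [/\ uniq D, {subset D <= s},
  size D = redundant F s & forall i, i \in D ->
    walk_edges (w i) \subset F :|: edges_of [seq k <- s | k \notin D]].
Proof.
elim: s F => [|i s IH] F /=; first by exists [::].
case/andP => is_ us; have [D [uD sD cD cov]] := IH (F :|: walk_edges (w i)) us.
have iD : i \notin D by apply: contra is_ => /sD.
case: (boolP (walk_edges (w i) \subset F)) => [EF|nEF].
  exists (i :: D); split => /=; rewrite ?iD ?cD //.
    by move=> k; rewrite !inE => /predU1P[->|/sD->]; rewrite ?eqxx ?orbT.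
  rewrite inE eqxx /=.
  have -> : [seq k <- s | k \notin i :: D] = [seq k <- s | k \notin D].
    apply: eq_in_filter => k ks; rewrite inE negb_or.
    by case: eqP => // ki; rewrite -ki ks in is_.
  move=> k; rewrite inE => /predU1P[->|/cov].
    exact: subset_trans EF (subsetUl _ _).
  by move/setUidPl: EF => ->.
exists D; split => //; first by move=> k /sD ks; rewrite inE ks orbT.
by rewrite iD /edges_of big_cons => k /cov; rewrite setUA.
Qed.

Definition closed_family X s := forall i, i \in s ->
  [/\ non_backtracking (w i), w i 0 \in X & w i a \in X].

Lemma closed_family_cons X i s : closed_family X (i :: s) ->
  [/\ non_backtracking (w i), w i 0 \in X, w i a \in X
    & closed_family (X :|: walk_verts (w i)) s].
Proof.
move=> cl; have [nb w0 wa] := cl i (mem_head _ _); split => // j sj.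
by have [] := cl j; rewrite inE ?sj ?orbT // => ? h1 h2; rewrite !inE h1 h2.
Qed.

Lemma supported1 X F i : supported X F ->
  supported (X :|: walk_verts (w i)) (F :|: walk_edges (w i)).
Proof.
by move=> /(@supportedU [:: i]); rewrite /verts_of /edges_of !big_seq1.
Qed.

(** Sum [walk_gain] over the walks, with [t] new vertices and [e] new edges in all. A walk that adds
    edges adds at most [a] of them and fewer vertices, whence [a * t <= (a - 1) * e]; each such walk
    also gains one edge over its vertices, whence [t + size s <= e + redundant F s]. *)
Lemma closed_family_gain X F s : supported X F -> closed_family X s ->
  a * #|X :|: verts_of s| + #|F :|: edges_of s| + a * #|F|
    <= a * #|F :|: edges_of s| + #|F| + a * #|X| /\
  #|X :|: verts_of s| + size s + #|F|
    <= #|F :|: edges_of s| + #|X| + redundant F s.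
Proof.
elim: s X F => [|i s IH] X F FX clX.
  by rewrite /verts_of /edges_of !big_nil !setU0 /=; split; lia.
have [nb w0 wa clX'] := closed_family_cons clX.
have [] := IH _ _ (supported1 (i := i) FX) clX'.
rewrite /verts_of /edges_of !big_cons !setUA /=.
have := walk_gain a_gt0 nb FX w0 wa.
rewrite [#|X :|: walk_verts _|]cardsUD [#|F :|: walk_edges _|]cardsUD.
have lea : #|walk_edges (w i) :\: F| <= a.
  exact: leq_trans (subset_leq_card (subsetDl _ _)) (card_walk_edges _).
case: ifP => [EF VX|_ ltT].
  have -> : walk_verts (w i) :\: X = set0 by apply/eqP; rewrite setD_eq0.
  have -> : walk_edges (w i) :\: F = set0 by apply/eqP; rewrite setD_eq0.
  by rewrite !cards0 !addn0; split; slia.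
by rewrite !mulnDr; split; slia.
Qed.

(* If no walk returns to u, then each walk either contributes a full set of a
   edges, or closes up before spending them all. *)
Lemma open_family_gain X F s u v :
    supported X F -> u \in X -> v \in X -> u != v ->
    (forall i, i \in s ->
      [/\ non_backtracking (w i), w i 0 = u, w i a = v
        & [set u; w i 1] \notin F]) ->
    uniq [seq w i 1 | i <- s] ->
  a * #|X :|: verts_of s| + #|F :|: edges_of s| + a * #|F|
    < a * #|F :|: edges_of s| + #|F| + a * #|X| \/
  #|F :|: edges_of s| = #|F| + a * size s.
Proof.
elim: s X F => [|i s IH] X F FX uX vX uv sP us.
  by right; rewrite /edges_of big_nil setU0 muln0 addn0.
have [nb w0 wa nF] := sP i (mem_head _ _).
have w0X : w i 0 \in X by rewrite w0.
have waX : w i a \in X by rewrite wa.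
have := walk_gain a_gt0 nb FX w0X waX.
have -> : (walk_edges (w i) \subset F) = false.
  by apply: contraNF nF => /subsetP; apply; rewrite -w0 walk_edge.
move=> ltT.
have lea : #|walk_edges (w i) :\: F| <= a.
  exact: leq_trans (subset_leq_card (subsetDl _ _)) (card_walk_edges _).
have FX' := supported1 (i := i) FX.
have clX' : closed_family (X :|: walk_verts (w i)) s.
  move=> j sj; have [|? -> -> _] := sP j; first by rewrite inE sj orbT.
  by rewrite !inE uX vX.
have [gain _] := closed_family_gain FX' clX'.
rewrite /verts_of /edges_of !big_cons !setUA in gain *.
have cX := cardsUD X (walk_verts (w i)).
have cF := cardsUD F (walk_edges (w i)).
(* Equality in the weighted bound forces [a] new edges and [a - 1] new vertices; anything less gives
   the strict alternative. *)
case: (boolP ((#|walk_edges (w i) :\: F| == a) &&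
              (#|walk_verts (w i) :\: X| == a.-1))) => [|not_full]; last first.
  left; move: gain; rewrite cX cF -/(verts_of s) -/(edges_of s).
  by move: not_full ltT lea; slia.
case/andP => /eqP fullE /eqP fullT.
have inner t := full_walk_interior (s := t) w0X waX (eq_leq (esym fullT)).
have uX' : u \in X :|: walk_verts (w i) by rewrite inE uX.
have vX' : v \in X :|: walk_verts (w i) by rewrite inE vX.
have us' : uniq [seq w j 1 | j <- s] by case/andP: us.
(* The walk just added meets [u] and [v] only at its ends, so its only edge at [u] is its first one,
   and the first edges of the walks are distinct. *)
have sP' j : j \in s -> [/\ non_backtracking (w j), w j 0 = u, w j a = v
    & [set u; w j 1] \notin F :|: walk_edges (w i)].
  move=> sj; have [|? wj0 wja njF] := sP j; first by rewrite inE sj orbT.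
  split=> //; rewrite inE negb_or njF; apply/negP => /walk_edgeP[t lta].
  move/setP => eqE; have := eqE u; rewrite !inE eqxx /=.
  case: t => [|t] in lta eqE *.
    move=> _; have := eqE (w i 1); rewrite !inE eqxx orbT.
    case/orP => [/eqP w1|/eqP w1].
      by case: nb => /(_ 0 a_gt0); rewrite w0 w1 eqxx.
    by move: us => /= /andP[/negP[]]; rewrite w1; apply: map_f.
  move/esym/orP => [] /eqP ut.
    by have := inner t.+1 lta; rewrite -ut uX.
  case: (ltngtP t.+2 a) lta => // [lta _|ta _].
    by have := inner t.+2 lta; rewrite -ut uX.
  by case/negP: uv; rewrite ut ta wa.
have [gain'|eqF] := IH _ _ FX' uX' vX' uv sP' us'.
  left; move: gain'; rewrite -/(verts_of s) -/(edges_of s) cX cF fullE fullT.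
  clear; slia.
by right; rewrite -/(edges_of s) eqF cF fullE /=; clear; slia.
Qed.

Lemma verts_of_degree s z (u v : V) (E : {set {set V}}) :
    (forall i, i \in s ->
      [/\ non_backtracking (w i), w i 0 = u & w i a = v]) ->
    (forall f, f \in edges_of s -> z \in f -> f \in E) ->
    z \in verts_of s -> z != u -> z != v ->
  2 <= #|[set f in E | z \in f]|.
Proof.
move=> sP zE /verts_ofP[i si /walk_vertP[t let_ zt]] zu zv.
have [nb w0 wa] := sP i si; rewrite zt in zE zu zv *.
apply: interior_degree => //.
  rewrite lt0n ltn_neqAle let_ andbT; apply/andP; split.
    by apply: contraNneq zu => ->; rewrite w0.
  by apply: contraNneq zv => ->; rewrite wa.
by move=> f fi; apply: zE; apply/edges_ofP; exists i.
Qed.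

Lemma edges_of_card s f :
  (forall i, i \in s -> non_backtracking (w i)) -> f \in edges_of s -> #|f| = 2.
Proof. by move=> nb /edges_ofP[i /nb/walk_edge_card]; apply. Qed.

Lemma end_degree s (u : V) (g : I -> V) (E : {set {set V}}) :
    (forall i, i \in s -> u != g i /\ [set u; g i] \in E) ->
    uniq [seq g i | i <- s] ->
  size s <= #|[set f in E | u \in f]|.
Proof.
move=> sP us; rewrite -(size_map g).
have ugs : {in [seq g i | i <- s] &, injective (fun z => [set u; z])}.
  move=> y z /mapP[i /sP[uy _] ->] /mapP[j /sP[uz _] ->] /setP/(_ (g i)).
  by rewrite !inE eqxx orbT eq_sym (negPf uy) => /esym/eqP.
rewrite -(card_uniqP us) -(card_in_imset ugs); apply: subset_leq_card.
apply/subsetP => f /imsetP[z /mapP[i /sP[_ uE] ->] ->].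
by rewrite !inE uE eqxx.
Qed.

Lemma first_edge s u v i : (forall i, i \in s ->
      [/\ non_backtracking (w i), w i 0 = u & w i a = v]) -> i \in s ->
  u != w i 1 /\ [set u; w i 1] \in edges_of s.
Proof.
move=> sP si; have [[nb _] <- _] := sP i si; split; first exact: nb.
by apply/edges_ofP; exists i => //; apply: walk_edge.
Qed.

Lemma last_edge s u v i : (forall i, i \in s ->
      [/\ non_backtracking (w i), w i 0 = u & w i a = v]) -> i \in s ->
  v != w i a.-1 /\ [set v; w i a.-1] \in edges_of s.
Proof.
move=> sP si; have [[nb _] _ <-] := sP i si.
have aE : a.-1.+1 = a by rewrite prednK.
have lta : a.-1 < a by rewrite prednK.
have := walk_edge (w i) lta; have := nb _ lta.
rewrite aE setUC eq_sym => ? ?; split=> //.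
by apply/edges_ofP; exists i.
Qed.

(** All edges at [v] are new, and so are the first edges at [u]. Hence [u] and [v] have at least
    [size s] new edges each and every other new vertex has two; as [v] is itself a new vertex but
    [u] is not, the incidence count leaves a loss of one. *)
Lemma fresh_end_gain X F s u v :
    supported X F -> u \in X -> v \notin X ->
    (forall i, i \in s ->
      [/\ non_backtracking (w i), w i 0 = u & w i a = v]) ->
    (forall i, i \in s -> w i 1 \notin X) ->
    uniq [seq w i 1 | i <- s] -> uniq [seq w i a.-1 | i <- s] ->
  #|X :|: verts_of s| + size s + #|F| <= #|F :|: edges_of s| + #|X| + 1.
Proof.
move=> FX uX vX sP w1X us1 usa; rewrite !cardsUD.
set T := verts_of s :\: X; set E := edges_of s :\: F.
have E2 f : f \in E -> #|f| = 2.
  by rewrite inE => /andP[_]; apply: edges_of_card => i /sP[].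
have uT : u \notin T by rewrite inE uX.
have newE f z : f \in edges_of s -> z \in f -> z \notin X -> f \in E.
  by move=> fE zf zX; rewrite inE fE andbT; apply: contra zX => /FX/subsetP; apply.
have degu : size s <= #|[set f in E | u \in f]|.
  apply: end_degree us1 => i si; have [uw wE] := first_edge sP si.
  by split=> //; apply: newE wE _ (w1X i si); rewrite !inE eqxx orbT.
have degv : size s <= #|[set f in E | v \in f]|.
  apply: end_degree usa => i si; have [uw wE] := last_edge sP si.
  by split=> //; apply: newE wE _ vX; rewrite !inE eqxx.
have degT z : z \in T -> z != v -> 2 <= #|[set f in E | z \in f]|.
  rewrite inE => /andP[zX zs] zv.
  apply: (@verts_of_degree s z u v) => // [f fs zf|]; first exact: newE zf zX.
  by apply: contraNneq zX => ->.
have := @handshake E (u |: (v |: T)) E2.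
rewrite big_setU1 /=; last first.
  by rewrite !inE uX /= orbF; apply: contraNneq vX => <-.
rewrite (big_setD1 v) /=; last by rewrite !inE eqxx.
have : 2 * #|T :\ v| <= \sum_(z in (v |: T) :\ v) #|[set f in E | z \in f]|.
  have -> : (v |: T) :\ v = T :\ v.
    by apply/setP=> z; rewrite !inE; case: eqP.
  rewrite mulnC -sum_nat_const; apply: leq_sum => z.
  by rewrite !in_setD1 => /andP[zv zT]; apply: degT.
have := cardsD1 v T; move: degu degv.
by case: (v \in T) => /=; lia.
Qed.

(** Degrees are at least two inside and [size s] at the ends. With two walks all degrees are at
    least two, even if [u = v]. *)
Lemma closed_theta_gain s u v : 1 < size s ->
    (forall i, i \in s ->
      [/\ non_backtracking (w i), w i 0 = u & w i a = v]) ->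
    uniq [seq w i 1 | i <- s] -> uniq [seq w i a.-1 | i <- s] ->
  (u != v -> #|verts_of s| + size s <= #|edges_of s| + 2) /\
  (size s = 2 -> #|verts_of s| <= #|edges_of s|).
Proof.
move=> s2 sP us1 usa.
have E2 f : f \in edges_of s -> #|f| = 2.
  by apply: edges_of_card => i /sP[].
have degu : size s <= #|[set f in edges_of s | u \in f]|.
  by apply: end_degree us1 => i si; apply: (first_edge sP si).
have degv : size s <= #|[set f in edges_of s | v \in f]|.
  by apply: end_degree usa => i si; apply: (last_edge sP si).
have degT z : z \in verts_of s -> z != u -> z != v ->
    2 <= #|[set f in edges_of s | z \in f]|.
  by move=> zs zu zv; apply: (@verts_of_degree s z u v).
have [i si] : exists i, i \in s
  by clear -s2; case: s s2 => // i s _; exists i; apply: mem_head.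
have [_ w0 wa] := sP i si.
have us : u \in verts_of s.
  by apply/verts_ofP; exists i => //; apply/walk_vertP; exists 0.
have vs : v \in verts_of s.
  by apply/verts_ofP; exists i => //; apply/walk_vertP; exists a.
have H := @handshake (edges_of s) (verts_of s) E2.
split=> [uv|ss].
  have vsu : v \in verts_of s :\ u by rewrite !inE eq_sym uv.
  move: (cardsD1 u (verts_of s)) (cardsD1 v (verts_of s :\ u)).
  move: H; rewrite (big_setD1 u us) /= (big_setD1 v vsu) /= us vsu.
  have : 2 * #|verts_of s :\ u :\ v| <=
      \sum_(z in verts_of s :\ u :\ v) #|[set f in edges_of s | z \in f]|.
    rewrite mulnC -sum_nat_const; apply: leq_sum => z.
    by rewrite 2!in_setD1 => /and3P[zv zu zs]; apply: degT.
  by move: degu degv; slia.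
have : 2 * #|verts_of s| <=
      \sum_(z in verts_of s) #|[set f in edges_of s | z \in f]|.
  rewrite mulnC -sum_nat_const; apply: leq_sum => z zs.
  have [->|zu] := eqVneq z u; first by rewrite -ss.
  have [->|zv] := eqVneq z v; first by rewrite -ss.
  exact: degT.
by move: H; lia.
Qed.

End Families.
End Walks.

(** * The color energy graph *)

Lemma uniq_flatten (T : eqType) (qs : seq (seq T)) :
  all (fun q => 0 < size q) qs -> uniq (flatten qs) -> uniq qs.
Proof.
elim: qs => //= q qs IH /andP[q_gt0 qs_gt0]; rewrite cat_uniq.
case/and3P => _ dis uqs; rewrite IH // andbT; apply/negP => q_in.
case: q q_gt0 dis q_in => // x q _ dis q_in; case/hasP: dis.
by exists x; rewrite ?mem_head //; apply/flattenP; exists (x :: q); rewrite ?mem_head.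
Qed.

Lemma theta_legs_uniq (T : finType) (e : rel T) a u v qs : 1 < a ->
  theta_legs e a u v qs -> uniq qs.
Proof.
move=> a_gt1 /andP[legs uq]; apply: uniq_flatten; last by case/and3P: uq.
by apply/allP => q /(allP legs) /andP[/eqP-> _]; lia.
Qed.

Lemma theta_legs_subset (T : finType) (e : rel T) a u v qs qs' : 1 < a ->
  theta_legs e a u v qs -> uniq qs' -> {subset qs' <= qs} ->
  theta_legs e a u v qs'.
Proof.
move=> a_gt1 th uqs' sub; have uqs := theta_legs_uniq a_gt1 th.
case/andP: th => legs uq; apply/andP; split.
  by apply/allP => q /sub; apply: (allP legs).
have perm : perm_eq qs' (filter (mem qs') qs).
  apply: uniq_perm; rewrite ?filter_uniq // => q; rewrite mem_filter /=.
  by case: (boolP (q \in qs')) => // /sub ->.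
have sfl : subseq (flatten (filter (mem qs') qs)) (flatten qs).
  elim: (qs) => //= q l IH; case: ifP => _ /=; first exact: cat_subseq.
  exact: subseq_trans IH (suffix_subseq _ _).
have /perm_uniq -> : perm_eq (u :: v :: flatten qs')
    (u :: v :: flatten (filter (mem qs') qs)) by rewrite !perm_cons perm_flatten.
by apply: subseq_uniq uq; rewrite /= !eqxx.
Qed.

Section TupleGraph.
(* lb c j is a matching in color c placed in the j-th coordinate, so energy_rel
   is a subgraph of the r-th color energy graph on V^r, for r = #|J|. *)
Variables (V B J : finType) (lb : B -> J -> rel V).
Hypothesis lb_sym : forall c j, symmetric (lb c j).
Hypothesis lb_irr : forall c j, irreflexive (lb c j).
Hypothesis lb_fun : forall c j x y y', lb c j x y -> lb c j x y' -> y = y'.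
Hypothesis lb_inj : forall c c' j j' x y,
  lb c j x y -> lb c' j' x y -> c = c' /\ j = j'.

Definition tup := {ffun J -> V}.
Implicit Types (x y u v : tup) (j : J) (c : B).

Definition energy_rel : rel tup :=
  fun x y => [exists c, forall j, lb c j (x j) (y j)].

Definition hue j (f : {set V}) : option B :=
  [pick c | [exists p : V * V, (f == [set p.1; p.2]) && lb c j p.1 p.2]].

Lemma hueP j f c : hue j f = Some c ->
  exists x y : V, f = [set x; y] /\ lb c j x y.
Proof.
rewrite /hue; case: pickP => // c' /existsP[[x y] /= /andP[/eqP-> lbc]] [<-].
by exists x, y.
Qed.

Lemma lb_hue j c (x y : V) : lb c j x y -> hue j [set x; y] = Some c.
Proof.
move=> lbc; case E: (hue j _) => [c'|].
  have [x' [y' [eqf lbc']]] := hueP E.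
  have : lb c' j x y.
    have xy : x != y by apply: contraTneq lbc => ->; rewrite lb_irr.
    move/setP: eqf => eqf; have := eqf x; have := eqf y.
    rewrite !inE !eqxx orbT /= => /esym/orP[]/eqP y1 /esym/orP[]/eqP x1; subst.
    - by rewrite eqxx in xy.
    - by rewrite lb_sym.
    - by [].
    - by rewrite eqxx in xy.
  by move=> /lb_inj /(_ lbc)[->].
move: E; rewrite /hue; case: pickP => // no _; have := no c.
by move/negbT/negP; case; apply/existsP; exists (x, y); rewrite /= eqxx.
Qed.

Lemma energy_sym : symmetric energy_rel.
Proof.
by move=> x y; apply: eq_existsb => c; apply: eq_forallb => j; rewrite lb_sym.
Qed.

Lemma energy_coord x y j : energy_rel x y -> x j != y j.
Proof.
move=> /existsP[c /forallP/(_ j) lbc].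
by apply: contraTneq lbc => ->; rewrite lb_irr.
Qed.

(** One coordinate of the edge reveals its color by [lb_inj], and the matchings of that color
    determine the other coordinates. *)
Lemma energy_nbr x y y' j :
  energy_rel x y -> energy_rel x y' -> y j = y' j -> y = y'.
Proof.
move=> /existsP[c /forallP xy] /existsP[c' /forallP xy'] yj.
have cc : c = c'.
  by have [] := lb_inj (xy j) (c' := c') (j' := j); rewrite // yj.
apply/ffunP => i; apply: lb_fun (xy i) _; rewrite cc; exact: xy'.
Qed.

(** * The coordinates of the legs of a theta graph *)

Section Legs.
Variables (a : nat) (u v : tup).
Hypothesis a_gt1 : 1 < a.

Definition leg_walk (q : seq tup) s := nth u (u :: rcons q v) s.
Definition leg_coord j q s := leg_walk q s j.

Definition leg_colors q : {set B} :=
  [set c | [exists s : 'I_a,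
    forall j, lb c j (leg_coord j q s) (leg_coord j q s.+1)]].
Definition colors_of qs : {set B} := \bigcup_(q <- qs) leg_colors q.

Lemma leg_colorP c q :
  reflect (exists2 s, s < a &
             forall j, lb c j (leg_coord j q s) (leg_coord j q s.+1))
          (c \in leg_colors q).
Proof.
rewrite inE; apply: (iffP existsP) => [[s /forallP H]|[s lts H]].
  by exists s.
by exists (Ordinal lts); apply/forallP.
Qed.

Lemma card_leg_colors j q : #|leg_colors q| <= a.
Proof.
rewrite -(card_imset _ (@Some_inj _)).
pose f (s : 'I_a) := hue j [set leg_coord j q s; leg_coord j q s.+1].
apply: (@leq_trans #|[set f s | s : 'I_a]|); last first.
  by rewrite -[X in _ <= X]card_ord; apply: leq_imset_card.
apply: subset_leq_card; apply/subsetP => _ /imsetP[c /leg_colorP[s lts H] ->].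
by apply/imsetP; exists (Ordinal lts); rewrite // /f (lb_hue (H j)).
Qed.

Lemma card_colors_of j qs : #|colors_of qs| <= a * size qs.
Proof.
rewrite /colors_of; elim: qs => [|q qs IH]; rewrite ?big_nil ?cards0 //.
rewrite big_cons mulnS; apply: leq_trans (leq_card_setU _ _) _.
by apply: leq_add; first exact: card_leg_colors j q.
Qed.

Variable g : rel tup.
Hypotheses (g_sym : symmetric g) (g_sub : subrel g energy_rel).
Variable qs : seq (seq tup).
Hypothesis theta : theta_legs g a u v qs.

Lemma leg_size q : q \in qs -> size q = a.-1.
Proof. by case/andP: theta => /allP legs _ /legs/andP[/eqP]. Qed.

Lemma leg_adj q s : q \in qs -> s < a -> g (leg_walk q s) (leg_walk q s.+1).
Proof.
move=> qin lts; case/andP: theta => /allP legs _.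
have /andP[/eqP sq /(pathP u)] := legs q qin; apply.
by rewrite size_rcons sq prednK // ltnW.
Qed.

Lemma leg_uniq q : q \in qs -> uniq (u :: rcons q v).
Proof.
case/andP: theta => _ uq qin.
have sub : subseq (u :: v :: q) (u :: v :: flatten qs).
  rewrite /= !eqxx; elim: (qs) qin => //= p l IH; rewrite inE.
  case/predU1P => [->|/IH H]; first exact: prefix_subseq.
  exact: subseq_trans H (suffix_subseq _ _).
rewrite (perm_uniq (s2 := [:: u, v & q])) ?(subseq_uniq sub) //.
by rewrite perm_cons perm_rcons.
Qed.

Lemma leg_walk0 q : leg_walk q 0 = u. Proof. by []. Qed.

Lemma leg_walk_end q : q \in qs -> leg_walk q a = v.
Proof.
move=> /leg_size sq; rewrite /leg_walk -(prednK (ltnW a_gt1)) /=.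
by rewrite nth_rcons sq ltnn eqxx.
Qed.

Lemma leg_walk_nth q s : q \in qs -> 0 < s < a -> leg_walk q s = nth u q s.-1.
Proof.
move=> /leg_size sq /andP[]; case: s => // s _ lts.
by rewrite /leg_walk /= nth_rcons sq ifT //; lia.
Qed.

(** If one coordinate returned after two steps, [energy_nbr] would identify the whole tuples, but a
    leg repeats none. *)
Lemma leg_non_backtracking j q : q \in qs ->
  non_backtracking a (leg_coord j q).
Proof.
move=> qin; split=> [s lts|s lts].
  exact/energy_coord/g_sub/leg_adj.
have /g_sub adj1 : g (leg_walk q s.+1) (leg_walk q s).
  by rewrite g_sym; apply: leg_adj (ltnW lts).
have /g_sub adj2 := leg_adj qin lts.
apply/eqP => /(energy_nbr adj1 adj2)/eqP; apply/negP.
have := leg_uniq qin => uq; have sq := leg_size qin.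
by rewrite nth_uniq //= ?size_rcons ?sq; lia.
Qed.

Lemma leg_closed j q : q \in qs ->
  [/\ non_backtracking a (leg_coord j q), leg_coord j q 0 = u j
    & leg_coord j q a = v j].
Proof.
move=> qin; split; first exact: leg_non_backtracking.
  by rewrite /leg_coord leg_walk0.
by rewrite /leg_coord leg_walk_end.
Qed.

Lemma uniq_legs_at s : 0 < s < a -> uniq [seq leg_walk q s | q <- qs].
Proof.
move=> s_in; rewrite map_inj_in_uniq ?(theta_legs_uniq a_gt1 theta) // => p q pin qin.
rewrite !leg_walk_nth // => pq.
have uf : uniq (flatten qs) by case/andP: theta => _ /and3P[].
have mem_nth' q' : q' \in qs -> nth u q' s.-1 \in q'.
  by move=> qin'; rewrite mem_nth // leg_size //; lia.
have := mem_nth' _ pin; have := mem_nth' _ qin; rewrite -{}pq.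
elim: (qs) uf pin qin => //= l ls IH; rewrite cat_uniq => /and3P[_ /hasPn dis uf].
have no x k : x \in l -> k \in ls -> x \in k -> False.
  move=> xl kls xk; have /dis/= : x \in flatten ls by apply/flattenP; exists k.
  by rewrite xl.
rewrite !inE => /predU1P[->|pls] /predU1P[->|qls] //.
- by move=> xq xl; case: (no _ q xl qls xq).
- by move=> xl xp; case: (no _ p xl pls xp).
- exact: IH.
Qed.

(** By [energy_nbr], distinct neighbors of [u] differ in every coordinate. *)
Lemma uniq_firsts j : uniq [seq leg_coord j q 1 | q <- qs].
Proof.
have /= um := uniq_legs_at (s := 1) a_gt1.
rewrite (map_comp (fun x => x j) (leg_walk^~ 1)) map_inj_in_uniq //.
move=> x y /mapP[p pin ->] /mapP[q qin ->].
by apply: (energy_nbr (x := u)); apply: g_sub; apply: (leg_adj _ (ltnW a_gt1)).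
Qed.

Lemma uniq_lasts j : uniq [seq leg_coord j q a.-1 | q <- qs].
Proof.
have /= um := uniq_legs_at (s := a.-1); have a1 : 0 < a.-1 < a by lia.
rewrite (map_comp (fun x => x j) (leg_walk^~ a.-1)).
rewrite map_inj_in_uniq ?um // => x y /mapP[p pin ->] /mapP[q qin ->].
have adjv r : r \in qs -> energy_rel v (leg_walk r a.-1).
  move=> rin; rewrite energy_sym; apply: g_sub.
  have lta : a.-1 < a by lia.
  by have := leg_adj rin lta; rewrite prednK ?leg_walk_end // ltnW.
by apply: (energy_nbr (x := v)); apply: adjv.
Qed.

Lemma uv_neq : u != v.
Proof. by case/andP: theta => _ /=; rewrite !inE negb_or => /and3P[/andP[]]. Qed.

Local Notation Vof j := (verts_of a (leg_coord j) qs).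

Lemma card_theta_verts j : #|[set u j; v j] :|: Vof j| <= 2 + size qs * a.-1.
Proof.
have -> : 2 + size qs * a.-1 = size (u :: v :: flatten qs).
  rewrite /= size_flatten /shape; have := leg_size.
  elim: (qs) => //= q l IH H; rewrite H ?mem_head // mulSn.
  by have := IH (fun p pl => H p (mem_behead (s := q :: l) pl)); lia.
rewrite -(size_map (fun x : tup => x j)); apply: leq_trans (card_size _).
apply: subset_leq_card; apply/subsetP => z /=; rewrite !inE -orbA.
case/or3P => [->|->|]; rewrite ?orbT //.
case/verts_ofP => q qin /walk_vertP[s les ->].
have : leg_walk q s \in u :: v :: flatten qs.
  have : leg_walk q s \in u :: rcons q v.
    by rewrite mem_nth //= size_rcons leg_size //; lia.
  rewrite !inE mem_rcons inE => /or3P[->//|->|xq]; rewrite ?orbT //.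
  by apply/orP; right; apply/orP; right; apply/flattenP; exists q.
rewrite !inE => /or3P[/eqP H|/eqP H|H]; rewrite /leg_coord ?H ?eqxx ?orbT //.
by apply/orP; right; apply/orP; right; apply: map_f.
Qed.

Lemma edge_color j s q : q \in qs -> s < a ->
  exists2 c, c \in leg_colors q &
    hue j [set leg_coord j q s; leg_coord j q s.+1] = Some c.
Proof.
move=> qin lts; have /g_sub/existsP[c /forallP H] := leg_adj qin lts.
exists c; first by apply/leg_colorP; exists s.
exact: lb_hue (H j).
Qed.

End Legs.

Definition config (X : J -> {set V}) (F : J -> {set {set V}}) (C : {set B}) :=
  forall j f, f \in F j -> f \subset X j /\ (exists2 c, c \in C & hue j f = Some c).

(** * Configurations excluded by the coloring *)

Section NoSaving.
Variables (a b r : nat) (g : rel tup).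
Let ell := 2 + b * a.-1.
Hypotheses (cardJ : #|J| = r) (r_gt1 : 1 < r) (ltra : r < a) (b_gt1 : 1 < b).
Hypotheses (g_sym : symmetric g) (g_sub : subrel g energy_rel).
Hypothesis g_deg : forall x y, g x y -> r * ell < degree g setT x.
(* All that is retained of the (p, q)-coloring condition. *)
Hypothesis no_saving : forall X F C, config X F C ->
  \sum_j #|X j| <= r * ell -> \sum_j #|F j| < #|C| + r.-1 * (a * b).

Let a_gt1 : 1 < a. Proof. exact: ltn_trans ltra. Qed.

Implicit Types (X : J -> {set V}) (F : J -> {set {set V}}) (C : {set B}).

(** By [energy_nbr], each vertex of [X j] blocks at most one neighbor of [x]. *)
Lemma card_blocked X x :
  #|[set z | g x z && [exists j, z j \in X j]]| <= \sum_j #|X j|.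
Proof.
have sub : [set z | g x z && [exists j, z j \in X j]]
    \subset \bigcup_j [set z | g x z && (z j \in X j)].
  apply/subsetP => z; rewrite !inE /= => /andP[gxz /existsP[j zj]].
  by apply/bigcupP; exists j; rewrite // inE gxz.
apply: leq_trans (subset_leq_card sub) _.
apply: (@leq_trans (\sum_j #|[set z | g x z && (z j \in X j)]|)).
  elim: (index_enum J) => [|j s IH]; rewrite ?big_nil ?cards0 // !big_cons.
  by apply: leq_trans (leq_card_setU _ _) _; rewrite leq_add2l.
apply: leq_sum => j _.
rewrite -(card_in_imset (f := fun z : tup => z j)).
  by apply: subset_leq_card; apply/subsetP => _ /imsetP[z + ->]; rewrite inE => /andP[].
move=> z z'; rewrite !inE => /andP[xz _] /andP[xz' _].
by apply: energy_nbr; apply: g_sub; eassumption.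
Qed.

Lemma fresh_nbr X x y : g x y -> \sum_j #|X j| <= r * ell ->
  exists2 z, g x z & forall j, z j \notin X j.
Proof.
move=> gxy leX; set bad := [set z | g x z && [exists j, z j \in X j]].
have lt : #|bad| < degree g setT x.
  exact: leq_ltn_trans (leq_trans (card_blocked X x) leX) (g_deg gxy).
have /set0Pn[z] : [set z in setT | g x z] :\: bad != set0.
  apply: contraTneq lt => /eqP; rewrite setD_eq0 => /subset_leq_card.
  by rewrite -leqNgt.
rewrite !inE /= => /andP[+ gxz]; rewrite gxz /= negb_exists => /forallP H.
by exists z.
Qed.

(** Attaches a neighbor of [x] that is new in all coordinates, but records only [s] of them; [s < r]
    serves to hit [r * ell] vertices exactly. *)
Lemma extend X F C x y s : config X F C -> (forall j, x j \in X j) -> g x y ->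
  \sum_j #|X j| <= r * ell -> s <= r ->
  exists X' F' C', [/\ config X' F' C', forall j, x j \in X' j,
    \sum_j #|X' j| = \sum_j #|X j| + s, \sum_j #|F' j| = \sum_j #|F j| + s
    & #|C'| <= #|C|.+1].
Proof.
move=> cfg xX gxy leX les.
have [z gxz zX] := fresh_nbr gxy leX.
have /g_sub/existsP[c /forallP lbc] := gxz.
have [S cS] : exists S : {set J}, #|S| = s.
  have [S [_ _ cS]] : exists S : {set J}, [/\ set0 \subset S, S \subset setT & #|S| = s].
    case: (leqP s #|J|); last by rewrite cardJ ltnNge les.
    rewrite -cardsT => les'.
    have /card_gt0P[S] : 0 < #|[set S : {set J} | S \subset setT & #|S| == s]|.
      by rewrite cards_draws bin_gt0.
    by rewrite inE => /andP[sS /eqP cS]; exists S; rewrite sub0set.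
  by exists S.
pose X' j := if j \in S then z j |: X j else X j.
pose F' j := if j \in S then [set x j; z j] |: F j else F j.
have sX j : X j \subset X' j by rewrite /X'; case: ifP => // _; apply: subsetUr.
exists X', F', (c |: C); split.
- move=> j f; have old : f \in F j ->
      f \subset X' j /\ (exists2 c0, c0 \in c |: C & hue j f = Some c0).
    move=> /cfg[fX [c0 c0C h0]]; split; first exact: subset_trans fX (sX j).
    by exists c0; rewrite // inE c0C orbT.
  rewrite {1}/F'; case: ifP => // jS; case/setU1P => [->|//].
  split; last by exists c; rewrite ?inE ?eqxx // (lb_hue (lbc j)).
  by apply/subsetP => w /set2P[]->; rewrite /X' jS !inE ?xX ?eqxx ?orbT.
- by move=> j; apply: (subsetP (sX j)).
- rewrite -cS -sum1_card [\sum_(i in S) 1]big_mkcond -big_split /=.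
  apply: eq_bigr => j _; rewrite /X'; case: ifP => _; last by rewrite addn0.
  by rewrite cardsU1 zX addnC.
- rewrite -cS -sum1_card [\sum_(i in S) 1]big_mkcond -big_split /=.
  apply: eq_bigr => j _; rewrite /F'; case: ifP => _; last by rewrite addn0.
  rewrite cardsU1 addnC; case: (boolP (_ \in F j)) => // /cfg[/subsetP H _].
  by have := zX j; rewrite H // !inE eqxx orbT.
- by rewrite cardsU1; case: (c \in C).
Qed.

(* A pendant tuple adds r vertices, r edges and at most one color, so all that
   matters is the balance below. *)
Lemma balance_lt X F C x y : config X F C -> (forall j, x j \in X j) -> g x y ->
  \sum_j #|X j| <= r * ell ->
  r * \sum_j #|F j| < r * #|C| + r.-1 * \sum_j #|X j| + r * r.-1 * (b - 2).
Proof.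
have [m] := ubnP (r * ell - \sum_j #|X j|); elim: m X F C => // m IH X F C.
move=> ltm cfg xX gxy leX; rewrite ltnNge; apply/negP => bal.
have ell_ab : ell + (b - 2) = a * b by rewrite /ell; nia.
have [rest|rest] := leqP r (r * ell - \sum_j #|X j|).
  have [X' [F' [C' [cfg' xX' cX' cF' cC']]]] := extend cfg xX gxy leX (leqnn r).
  have leX' : \sum_j #|X' j| <= r * ell by rewrite cX'; lia.
  have ltm' : r * ell - \sum_j #|X' j| < m by rewrite cX'; lia.
  have := IH _ _ _ ltm' cfg' xX' gxy leX'.
  have h1 : r * #|C'| <= r * #|C| + r by rewrite -mulnSr leq_mul2l cC' orbT.
  have h2 : r.-1 * r + r = r * r by rewrite addnC -mulSn prednK // ltnW.
  by rewrite cX' cF' !mulnDr; move: bal h1 h2; lia.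
have arith (k e c : nat) : r * c + r.-1 * k + r * r.-1 * (b - 2) <= r * e ->
    r.-1 * k = r.-1 * (r * ell) - r.-1 * (r * ell - k) ->
    r * c + r * (r.-1 * (a * b)) <= r * e + r.-1 * (r * ell - k).
  have : r * (r.-1 * (a * b)) = r.-1 * (r * ell) + r * r.-1 * (b - 2).
    by rewrite -ell_ab; lia.
  lia.
have E : r.-1 * (\sum_j #|X j|) =
    r.-1 * (r * ell) - r.-1 * (r * ell - \sum_j #|X j|).
  by rewrite -mulnBr; congr (_ * _); lia.
have {arith bal E} := arith _ _ _ bal E.
have [->|pos] := posnP (r * ell - \sum_j #|X j|).
  rewrite muln0 addn0 -mulnDr leq_pmul2l; last exact: ltnW.
  by have := no_saving cfg leX; lia.
(* Fewer than [r] vertices are missing. Part of a pendant tuple may still cost a whole color, and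
   the strict inequality in [no_saving] pays for it. *)
have [X' [F' [C' [cfg' xX' cX' cF' cC']]]] := extend cfg xX gxy leX (ltnW rest).
have leX' : \sum_j #|X' j| <= r * ell by rewrite cX'; lia.
have := no_saving cfg' leX'; rewrite cF'; move: rest pos cC'.
move: (r * ell - _) => k ltk k_gt0 leC lt bal.
have : r * (\sum_j #|F j| + k) <= r * (#|C| + r.-1 * (a * b)).
  by rewrite leq_mul2l; apply/orP; right; lia.
have : r * k = r.-1 * k + k by rewrite addnC -mulSn prednK // ltnW.
by rewrite !mulnDr; lia.
Qed.

Local Notation Vof u v qs j := (verts_of a (leg_coord u v j) qs).
Local Notation Eof u v qs j := (edges_of a (leg_coord u v j) qs).

Lemma config_legs X F C u v qs : config X F C -> theta_legs g a u v qs ->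
  config (fun j => X j :|: Vof u v qs j) (fun j => F j :|: Eof u v qs j)
    (C :|: colors_of a u v qs).
Proof.
move=> cfg th j f /setUP[/cfg[fX [c cC hc]]|/edges_ofP[q qin /walk_edgeP[s lts fE]]].
  split; first exact: subset_trans fX (subsetUl _ _).
  by exists c; rewrite // inE cC.
have [c cq hc] := edge_color a_gt1 g_sub th j qin lts.
rewrite fE; split; last first.
  by exists c; rewrite // inE; apply/orP; right; apply/mem_bigcup_seq; exists q.
apply/subsetP => z zf; rewrite inE; apply/orP; right; apply/verts_ofP.
exists q => //; apply/walk_vertP.
by case/set2P: zf => ->; [exists s => //; apply: ltnW | exists s.+1].
Qed.

(** Each new color has an edge of its own in coordinate [j]; it is new, since the edges in [F j]
    have colors in [C]. *)
Lemma new_colors X F C u v qs j : config X F C ->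
  #|C :|: colors_of a u v qs| + #|F j| <= #|F j :|: Eof u v qs j| + #|C|.
Proof.
move=> cfg; rewrite !cardsUD.
suff : #|colors_of a u v qs :\: C| <= #|Eof u v qs j :\: F j| by slia.
rewrite -(card_imset _ (@Some_inj _)).
apply: leq_trans (leq_imset_card (hue j) _).
apply: subset_leq_card; apply/subsetP => _ /imsetP[c + ->].
rewrite inE => /andP[cC /mem_bigcup_seq[q qin /leg_colorP[s lts H]]].
apply/imsetP; exists [set leg_coord u v j q s; leg_coord u v j q s.+1]; last first.
  by rewrite (lb_hue (H j)).
rewrite inE; apply/andP; split; last first.
  by apply/edges_ofP; exists q => //; apply: walk_edge.
apply: contra cC => /cfg[_ [c' c'C]]; by rewrite (lb_hue (H j)) => -[->].
Qed.

Lemma no_rich_theta u v qs : theta_legs g a u v qs -> size qs = b ->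
  (forall j, #|Vof u v qs j| + b <= #|Eof u v qs j| + 2) -> False.
Proof.
move=> th sqs bal.
have cfg0 : config (fun=> set0) (fun=> set0) set0 by move=> j f; rewrite inE.
have cfg := config_legs cfg0 th.
have [q qin] : exists q, q \in qs.
  by case: (qs) sqs b_gt1 => [<-//|q l _ _]; exists q; rewrite mem_head.
have lt0a : 0 < a by apply: ltnW.
have guz : g u (leg_walk u v q 1) := leg_adj a_gt1 th qin lt0a.
have uX j : u j \in set0 :|: Vof u v qs j.
  rewrite set0U; apply/verts_ofP; exists q => //; apply/walk_vertP.
  by exists 0.
have leX : \sum_j #|set0 :|: Vof u v qs j| <= r * ell.
  rewrite -cardJ -sum_nat_const; apply: leq_sum => j _.
  have := card_theta_verts a_gt1 th j; rewrite sqs -/ell; apply: leq_trans.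
  by rewrite set0U; apply/subset_leq_card/subsetUr.
have := balance_lt cfg uX guz leX; rewrite ltnNge => /negP; apply.
have : \sum_j (#|set0 :|: colors_of a u v qs| + r.-1 * #|set0 :|: Vof u v qs j|
         + r.-1 * (b - 2)) <= \sum_j r * #|set0 :|: Eof u v qs j|.
  apply: leq_sum => j _; have := new_colors u v qs j cfg0; have := bal j.
  rewrite !set0U !cards0 !addn0 => h1 h2.
  have h3 : r.-1 * (#|Vof u v qs j| + (b - 2)) <= r.-1 * #|Eof u v qs j|.
    by rewrite leq_mul2l; apply/orP; right; lia.
  have h4 : r * #|Eof u v qs j| = r.-1 * #|Eof u v qs j| + #|Eof u v qs j|.
    by rewrite addnC -mulSn prednK // ltnW.
  by move: h2 h3; rewrite h4 mulnDr; slia.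
rewrite 2!big_split -!big_distrr /= !sum_nat_const cardJ.
by rewrite (mulnCA r.-1) -[r * r.-1 * _]mulnA.
Qed.

Theorem no_short_cycle u v qs : b = 2 -> theta_legs g a u v qs ->
  size qs = b -> False.
Proof.
move=> b2 th sqs; apply: (no_rich_theta th sqs) => j.
have closed i : i \in qs -> _ := leg_closed a_gt1 g_sym g_sub th j (q := i).
have [|_ H] := closed_theta_gain (ltnW a_gt1) _ closed
  (uniq_firsts a_gt1 g_sub th j) (uniq_lasts a_gt1 g_sub th j).
  by rewrite sqs.
by rewrite b2 leq_add2r; apply: H; rewrite sqs.
Qed.

(** Greedy: at most one leg starts with a given edge of [F j], and a chosen leg adds at most [a]
    edges in each of the [r] coordinates. A leg whose first edge is new is not redundant. *)
Lemma select_legs m u v qs (F : J -> {set {set V}}) : theta_legs g a u v qs ->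
  \sum_j #|F j| + r * a * m < size qs ->
  exists qs', [/\ size qs' = m, uniq qs', {subset qs' <= qs},
    forall j q, q \in qs' -> [set leg_coord u v j q 0; leg_coord u v j q 1] \notin F j
    & forall j, redundant a (leg_coord u v j) (F j) qs' = 0].
Proof.
move=> th; elim: m F => [|m IH] F ltF; first by exists [::].
pose e1 j q : {set V} := [set leg_coord u v j q 0; leg_coord u v j q 1].
have [q qin qF] : exists2 q, q \in qs & forall j, e1 j q \notin F j.
  case: (boolP (all (fun q => [exists j, e1 j q \in F j]) qs)) => [/allP bad|];
    last by case/allPn => q qin; rewrite negb_exists => /forallP; exists q.
  have le_j j : size (filter (fun q => e1 j q \in F j) qs) <= #|F j|.
    have un : uniq [seq e1 j q | q <- qs].
      rewrite (map_comp (fun z => [set u j; z]) (fun q => leg_coord u v j q 1)).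
      rewrite map_inj_in_uniq; first exact: (uniq_firsts a_gt1 g_sub th j).
      move=> y z /mapP[p pin ->] /mapP[p' pin' ->] /setP/(_ (leg_coord u v j p 1)).
      have [[nb _] p0 _] := leg_closed a_gt1 g_sym g_sub th j pin.
      have := nb 0 (ltnW a_gt1); rewrite p0 eq_sym !inE eqxx orbT.
      by move=> /negPf-> /esym/eqP.
    rewrite -(size_map (e1 j)).
    have unf : uniq [seq e1 j q | q <- qs & e1 j q \in F j].
      by apply: subseq_uniq un; apply/map_subseq/filter_subseq.
    rewrite -(card_uniqP unf); apply: subset_leq_card.
    by apply/subsetP => f /mapP[p]; rewrite mem_filter => /andP[pF _] ->.
  suff : size qs <= \sum_j size (filter (fun q => e1 j q \in F j) qs).
    move=> le1; have : size qs <= \sum_j #|F j|.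
      by apply: leq_trans le1 _; apply: leq_sum.
    by move: ltF; lia.
  elim: (qs) bad => //= p l IHl bad.
  have {}IHl := IHl (fun q ql => bad q (mem_behead (s := p :: l) ql)).
  have /existsP[j0 pj0] := bad p (mem_head _ _).
  have -> : \sum_j size (if e1 j p \in F j then
        p :: [seq q <- l | e1 j q \in F j] else [seq q <- l | e1 j q \in F j])
      = \sum_j (e1 j p \in F j) + \sum_j size [seq q <- l | e1 j q \in F j].
    by rewrite -big_split; apply: eq_bigr => j _; case: ifP.
  rewrite -add1n; apply: leq_add IHl; rewrite (bigD1 j0) //= pj0.
  exact: leq_addr.
pose F' j := F j :|: walk_edges a (leg_coord u v j q).
have [|qs' [sqs' uqs' sub qF' red]] := IH F'.
  apply: leq_ltn_trans ltF; rewrite mulnS addnA leq_add2r -cardJ -sum_nat_const.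
  rewrite -big_split; apply: leq_sum => j _; apply: leq_trans (leq_card_setU _ _) _.
  by rewrite leq_add2l card_walk_edges.
have [j0 _] : exists j0 : J, true.
  by have /card_gt0P[j0 _] : 0 < #|J|; [rewrite cardJ ltnW | exists j0].
have qe1 j : e1 j q \in walk_edges a (leg_coord u v j q).
  exact: walk_edge (ltnW a_gt1).
exists (q :: qs'); split => /=.
- by rewrite sqs'.
- rewrite uqs' andbT; apply/negP => /(qF' j0).
  by rewrite inE negb_or -/(e1 _ _) qe1 andbF.
- by move=> p; rewrite inE => /predU1P[->//|/sub].
- move=> j p; rewrite inE => /predU1P[->|/(qF' j)]; first exact: qF.
  by rewrite inE negb_or => /andP[].
- move=> j; rewrite red addn0; apply/eqP; rewrite eqb0; apply/negP.
  by move/subsetP => /(_ _ (qe1 j)); apply/negP.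
Qed.

Theorem no_large_theta u v qs : theta_legs g a u v qs -> r * a * b < size qs ->
  False.
Proof.
move=> th ltq.
have [|qs' [sqs' uqs' sub _ red]] := select_legs (m := b) (F := fun=> set0) th.
  by rewrite big1 ?add0n // => j _; rewrite cards0.
have th' := theta_legs_subset a_gt1 th uqs' sub.
apply: (no_rich_theta th' sqs') => j.
have FX : supported [set u j; v j] set0 by move=> f; rewrite inE.
have cl : closed_family a (leg_coord u v j) [set u j; v j] qs'.
  move=> q /(leg_closed a_gt1 g_sym g_sub th' j)[nb -> ->].
  by rewrite !inE !eqxx orbT.
have [_] := closed_family_gain (ltnW a_gt1) FX cl.
rewrite red cards0 set0U sqs' !addn0; apply: contraLR; rewrite -!ltnNge => lt.
have := subset_leq_card (subsetUr [set u j; v j] (Vof u v qs' j)).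
have : #|[set u j; v j]| <= 2 by rewrite cards2; case: (_ != _).
by move: lt; slia.
Qed.

(* Two of the legs use only colors of the others; a leg for each of their 2a
   edges suffices to cover them, whence the size 2a + 2. *)
Definition bad_bunch u v qs := [/\ theta_legs g a u v qs, 1 < size qs,
  size qs <= 2 * a + 2 & #|colors_of a u v qs| <= a * (size qs - 2)].

Definition rich u := forall Z : {set tup}, #|Z| <= r * ell ->
  exists v qs, bad_bunch u v qs /\ forall q, q \in qs -> leg_walk u v q 1 \notin Z.

(** Each of the at most [2a] edges of two redundant legs in coordinate [j] lies on some nonredundant
    leg; since [hue] reads the color off that one coordinate, the two legs have no colors of their
    own. *)
Lemma redundant_bunch u v qs j : theta_legs g a u v qs ->
  1 < redundant a (leg_coord u v j) set0 qs ->
  exists2 qs', {subset qs' <= qs} & bad_bunch u v qs'.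
Proof.
move=> th; have uqs := theta_legs_uniq a_gt1 th.
have [D [uD sD <- cov]] := redundant_cover a (leg_coord u v j) set0 uqs.
case: D uD sD cov => [//|q1 [//|q2 D]] uD sD cov _.
set D0 := [:: q1, q2 & D] in uD sD cov.
pose W q := walk_edges a (leg_coord u v j q).
set s := [seq k <- qs | k \notin D0] in cov.
pose E2 := W q1 :|: W q2.
pose cover f := head [::] [seq p <- s | f \in W p].
have coverP f : f \in E2 -> f \in W (cover f) /\ cover f \in s.
  move=> fE; have : f \in edges_of a (leg_coord u v j) s.
    case/setUP: fE => fq.
      have /subsetP/(_ _ fq) := cov q1 (mem_head _ _); by rewrite set0U.
    have : q2 \in D0 by rewrite !inE eqxx orbT.
    by move/cov/subsetP/(_ _ fq); rewrite set0U.
  case/edges_ofP => p ps fp.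
  have : has (fun p => f \in W p) s by apply/hasP; exists p.
  rewrite has_filter /cover; case E: (filter _ _) => [|p' l] // _ /=.
  have : p' \in [seq p <- s | f \in W p] by rewrite E mem_head.
  by rewrite mem_filter => /andP[].
pose R := undup [seq cover f | f <- enum E2].
have Rs q : q \in R -> q \in s.
  by rewrite mem_undup => /mapP[f]; rewrite mem_enum => /coverP[_ ?] ->.
have sub : {subset [:: q1, q2 & R] <= qs}.
  move=> q; rewrite !inE => /or3P[/eqP->|/eqP->|/Rs].
  - by apply: sD; rewrite mem_head.
  - by apply: sD; rewrite !inE eqxx orbT.
  - by rewrite mem_filter => /andP[].
have uR : uniq [:: q1, q2 & R].
  have q12 : q1 != q2 by move: uD; rewrite /= inE negb_or => /andP[/andP[]].
  rewrite /= undup_uniq andbT inE negb_or q12 /=; apply/andP; split;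
    by apply/negP => /Rs; rewrite mem_filter !inE eqxx ?orbT.
exists [:: q1, q2 & R] => //; split => //.
- exact: theta_legs_subset th uR sub.
- have leE : #|E2| <= a + a.
    apply: leq_trans (leq_card_setU _ _) _.
    by apply: leq_add; apply: card_walk_edges.
  have : size R <= #|E2|.
    by apply: leq_trans (size_undup _) _; rewrite size_map cardE.
  by move=> /leq_trans/(_ leE) /=; lia.
rewrite /= subn2 /=; apply: leq_trans (card_colors_of a u v j R).
apply: subset_leq_card; apply/subsetP => c /mem_bigcup_seq[q qin cq].
apply/mem_bigcup_seq; move: qin.
have toR : q \in [:: q1; q2] -> exists2 p, p \in R & c \in leg_colors a u v p.
  move=> q12; case/leg_colorP: cq => t lta H.
  pose f := [set leg_coord u v j q t; leg_coord u v j q t.+1].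
  have fE : f \in E2.
    have fW : f \in W q by apply: walk_edge.
    by move: q12; rewrite !inE => /orP[]/eqP <-; rewrite fW ?orbT.
  have [/walk_edgeP[t' lta' fE'] fs] := coverP f fE.
  exists (cover f); first by rewrite mem_undup; apply: map_f; rewrite mem_enum.
  have fqs : cover f \in qs by move: fs; rewrite mem_filter => /andP[].
  have [c' c'p] := edge_color a_gt1 g_sub th j fqs lta'.
  by rewrite -fE' /f (lb_hue (H j)) => -[->].
rewrite !inE => /or3P[q1E|q2E|qR]; last by exists q.
- by apply: toR; rewrite !inE q1E.
- by apply: toR; rewrite !inE q2E orbT.
Qed.

(** In these three lemmas [t] and [e] are the new vertices and edges in one coordinate, [k] the new
    colors and [m] the number of legs. They serve the cases of [rich_step]: the far end equals the
    near one, is another old vertex, or is new in that coordinate. *)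
Lemma closed_arith t e k : a * t + e <= a * e -> k <= e ->
  a.-1 * k + r.-1 * a * t <= r * a.-1 * e.
Proof.
case: a a_gt1 => // a' _; case: r r_gt1 => // r' _ /= h1 h2.
have : r' * (a'.+1 * t) <= r' * (a' * e) by rewrite leq_mul2l; lia.
have : a' * k <= a' * e by rewrite leq_mul2l h2 orbT.
lia.
Qed.

(** If the vertex bound is not strict, then [e = a * m] exceeds [a * (m - 2) >= k], and the missing
    colors give strictness. *)
Lemma open_arith t e k m : a * t + e <= a * e -> k <= e -> 1 < m ->
  k <= a * (m - 2) -> a * t + e < a * e \/ e = a * m ->
  a.-1 * k + r.-1 * a * t < r * a.-1 * e.
Proof.
case: a a_gt1 => [//|a'] a1; case: r r_gt1 => [//|r'] r1 /= h1 h2 m2 h3 h4.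
have h5 : r' * (a'.+1 * t) <= r' * (a' * e) by rewrite leq_mul2l; lia.
have h6 : a' * k <= a' * e by rewrite leq_mul2l h2 orbT.
case: h4 => [h4|em].
  have : r' * (a'.+1 * t) < r' * (a' * e) by rewrite ltn_mul2l; lia.
  by lia.
have : a' * k < a' * e by rewrite ltn_mul2l em; apply/andP; split; [lia|nia].
by lia.
Qed.

(** Split the weight [a - 1] of [k] as [(a - r) + (r - 1)] and estimate the first part by [k <= e],
    the second by [k <= a * (m - 2)]. The two legs without colors of their own outweigh the one new
    end. *)
Lemma fresh_arith t e k m : t + m <= e + 1 -> k <= e -> 1 < m ->
  k <= a * (m - 2) -> a.-1 * k + r.-1 * a * t < r * a.-1 * e.
Proof.
move=> h1 h2 m2 h3.
have [d aE] : exists d, a = r + d by exists (a - r); lia.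
have [r' rE] : exists r', r = r'.+1 by exists r.-1; lia.
rewrite aE rE addSn /= in h3 *.
have h4 : r' * (r' + d).+1 * t + r' * (r' + d).+1 * m <=
          r' * (r' + d).+1 * e + r' * (r' + d).+1.
  by rewrite -mulnDr -{3}[r' * _]muln1 -mulnDr leq_mul2l h1 orbT.
have h5 : d * k <= d * e by rewrite leq_mul2l h2 orbT.
have h6 : r' * k + r' * (r' + d).+1 * 2 <= r' * (r' + d).+1 * m.
  have -> : m = (m - 2) + 2 by lia.
  by rewrite mulnDr leq_add2r -mulnA leq_mul2l h3 orbT.
have h7 : 0 < r' * (r' + d).+1 by rewrite muln_gt0; lia.
by move: h4 h5 h6 h7; clear; lia.
Qed.

(** Bounds the vertices added by a bad bunch: at most [2a + 2] legs, [a] vertices beyond the start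
    on each, [r] coordinates. *)
Let S := r * ((2 * a + 2) * a).

(* Each step raises r(a-1)(|F| - |C|) - (r-1)a|X|, while balance_lt bounds this
   quantity; for b large there is room for more steps than that. *)
Lemma rich_step X F C u : rich u -> config X F C -> (forall j, u j \in X j) ->
  \sum_j #|X j| <= r * ell ->
  exists X' F' C', [/\ config X' F' C', forall j, u j \in X' j,
    \sum_j #|X' j| <= \sum_j #|X j| + S &
    r * a.-1 * \sum_j #|F j| + r * a.-1 * #|C'| + r.-1 * a * \sum_j #|X' j|
      < r * a.-1 * \sum_j #|F' j| + r * a.-1 * #|C| + r.-1 * a * \sum_j #|X j|].
Proof.
move=> rich_u cfg uX leX.
(* Avoiding the blocked neighbors makes the second vertex of every leg new in every coordinate. *)
have [v [qs [[th m2 lem lec] avoid]]] := rich_u _ (leq_trans (card_blocked X u) leX).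
have nX q j : q \in qs -> leg_coord u v j q 1 \notin X j.
  move=> qin; have := avoid q qin; rewrite inE.
  have guq : g u (leg_walk u v q 1) := leg_adj a_gt1 th qin (ltnW a_gt1).
  by rewrite guq /= negb_exists => /forallP/(_ j).
have closed j := fun q => leg_closed (q := q) a_gt1 g_sym g_sub th j.
have FX j : supported (X j) (F j) by move=> f /cfg[].
pose t j := #|Vof u v qs j :\: X j|; pose e j := #|Eof u v qs j :\: F j|.
pose k := #|colors_of a u v qs :\: C|.
have cX j : #|X j :|: Vof u v qs j| = #|X j| + t j := cardsUD _ _.
have cF j : #|F j :|: Eof u v qs j| = #|F j| + e j := cardsUD _ _.
have cC : #|C :|: colors_of a u v qs| = #|C| + k := cardsUD _ _.
have lek j : k <= e j.
  by have := new_colors u v qs j cfg; rewrite cC cF; lia.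
have lekm : k <= a * (size qs - 2).
  exact: leq_trans (subset_leq_card (subsetDl _ _)) lec.
have let_ j : t j <= (2 * a + 2) * a.
  have sub : Vof u v qs j :\: X j \subset
      \bigcup_(q <- qs) [set leg_coord u v j q (val s).+1 | s : 'I_a].
    apply/subsetP => z; rewrite inE => /andP[zX /verts_ofP[q qin /walk_vertP[s les zE]]].
    apply/mem_bigcup_seq; exists q => //; apply/imsetP.
    case: s les zE => [_ zE|s lts zE]; last by exists (Ordinal lts).
    by rewrite zE (_ : leg_coord _ _ _ _ _ = u j) ?uX // in zX.
  apply: leq_trans (subset_leq_card sub) _.
  apply: (@leq_trans (size qs * a)); last by rewrite leq_mul2r lem orbT.
  elim: (qs) => [|q l IH]; rewrite ?big_nil ?cards0 // big_cons mulSn.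
  apply: leq_trans (leq_card_setU _ _) _; apply: leq_add IH.
  by rewrite -[X in _ <= X]card_ord; apply: leq_imset_card.
have weak j : v j \in X j -> a * t j + e j <= a * e j.
  move=> vX; have cl : closed_family a (leg_coord u v j) (X j) qs.
    by move=> q /(closed j)[nb -> ->]; rewrite uX vX.
  have [] := closed_family_gain (ltnW a_gt1) (FX j) cl.
  by rewrite cX cF; lia.
have strict j : v j != u j -> a.-1 * k + r.-1 * a * t j < r * a.-1 * e j.
  move=> vu; case: (boolP (v j \in X j)) => vX.
    apply: (open_arith (m := size qs)) => //; first exact: weak.
    have sP q : q \in qs -> [/\ non_backtracking a (leg_coord u v j q),
        leg_coord u v j q 0 = u j, leg_coord u v j q a = v j
        & [set u j; leg_coord u v j q 1] \notin F j].
      move=> qin; have [nb q0 qa] := closed j q qin; split=> //.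
      apply: contra (nX q j qin) => /FX/subsetP; apply.
      by rewrite !inE eqxx orbT.
    have uv : u j != v j by rewrite eq_sym.
    have := open_family_gain (ltnW a_gt1) (FX j) (uX j) vX uv sP
      (uniq_firsts a_gt1 g_sub th j).
    by rewrite cX cF; slia.
  apply: (fresh_arith (m := size qs)) => //.
  have := fresh_end_gain (ltnW a_gt1) (FX j) (uX j) vX (closed j)
    (fun q => nX q j) (uniq_firsts a_gt1 g_sub th j) (uniq_lasts a_gt1 g_sub th j).
  by rewrite cX cF; slia.
have loose j : a.-1 * k + r.-1 * a * t j <= r * a.-1 * e j.
  case: (eqVneq (v j) (u j)) => [vu|/strict/ltnW//].
  by apply: closed_arith => //; apply: weak; rewrite vu.
(* The gain is strict in any coordinate that separates the ends, and they are distinct as tuples. *)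
have [j0 j0P] : exists j, v j != u j.
  apply/existsP; have := uv_neq th; apply: contraR; rewrite negb_exists.
  by move=> /forallP H; apply/eqP/ffunP => j; have /negPn/eqP := H j.
exists (fun j => X j :|: Vof u v qs j), (fun j => F j :|: Eof u v qs j),
  (C :|: colors_of a u v qs); split.
- exact: config_legs.
- by move=> j; rewrite inE uX.
- rewrite /S -cardJ -sum_nat_const -big_split /=; apply: leq_sum => j _.
  by rewrite cX leq_add2l.
have sX : \sum_j #|X j :|: Vof u v qs j| = \sum_j #|X j| + \sum_j t j.
  by rewrite -big_split; apply: eq_bigr => j _; apply: cX.
have sF : \sum_j #|F j :|: Eof u v qs j| = \sum_j #|F j| + \sum_j e j.
  by rewrite -big_split; apply: eq_bigr => j _; apply: cF.
have : \sum_j (a.-1 * k + r.-1 * a * t j) < \sum_j r * a.-1 * e j.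
  rewrite (bigD1 j0) //= [X in _ < X](bigD1 j0) //= -addSn.
  by apply: leq_add; [apply: strict | apply: leq_sum => j _].
rewrite big_split /= sum_nat_const cardJ -!big_distrr /= sX sF cC !mulnDr.
by slia.
Qed.

Hypothesis b_large : a * a * ((2 * a + 2) * a) ^ 2 < b.

(** Multiply the balance by [a - 1] and eliminate [f] and [c], using [(a - 1)(b - 2) = ell - 2a].
    The result bounds the number [i] of accumulation steps. *)
Lemma balance_arith (f c x i : nat) : r * f < r * c + r.-1 * x + r * r.-1 * (b - 2) ->
  r * a.-1 * c + r.-1 * a * x + i <= r * a.-1 * f + r.-1 * a * r ->
  r.-1 * x + i + r.-1 * (r * a) <= r.-1 * (r * ell).
Proof.
have [a' aE] : exists a', a = a'.+1 by exists a.-1; lia.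
have [r' rE] : exists r', r = r'.+1 by exists r.-1; lia.
have [b' bE] : exists b', b = b' + 2 by exists (b - 2); lia.
rewrite /ell aE rE bE /= addnK => h1 h2.
have : a' * (r'.+1 * f) <= a' * (r'.+1 * c + r' * x + r'.+1 * r' * b').
  by rewrite leq_mul2l ltnW ?orbT.
by move: h2; clear; lia.
Qed.

Lemma no_rich u : rich u -> False.
Proof.
move=> rich_u.
have [z guz] : exists z, g u z.
  have [v [qs [[th m2 _ _] _]]] : exists v qs, bad_bunch u v qs /\
      forall q, q \in qs -> leg_walk u v q 1 \notin set0.
    by apply: rich_u; rewrite cards0.
  have [q qin] : exists q, q \in qs.
    by case: (qs) m2 => [//|q l _]; exists q; rewrite mem_head.
  by exists (leg_walk u v q 1); apply: (leg_adj a_gt1 th qin (ltnW a_gt1)).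
(* Room for [r.-1 * S] steps of at most [S] new vertices each; it comes from [b_large], as [r < a]
   and [b <= ell]. *)
have leS : r + r.-1 * S * S <= r * ell.
  have : S * S <= r * (r * ((2 * a + 2) * a) ^ 2) by rewrite /S; lia.
  move=> h1; have h2 : r.-1 * (S * S) <= r.-1 * (r * (r * ((2 * a + 2) * a) ^ 2)).
    by rewrite leq_mul2l h1 orbT.
  have h3 : r.-1 * (r * ((2 * a + 2) * a) ^ 2) <= a * a * ((2 * a + 2) * a) ^ 2.
    by rewrite mulnA leq_mul2r; apply/orP; right; apply: leq_mul; lia.
  have h4 : 1 + r.-1 * (r * ((2 * a + 2) * a) ^ 2) <= ell.
    apply: (@leq_trans b); first by rewrite add1n (leq_ltn_trans h3).
    by apply: leq_trans (leq_addl _ _); apply: leq_pmulr; lia.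
  have h5 : r * (1 + r.-1 * (r * ((2 * a + 2) * a) ^ 2)) <= r * ell.
    by rewrite leq_mul2l h4 orbT.
  by move: h2 h5; rewrite mulnDr muln1 -[r.-1 * S * S]mulnA; lia.
(* The number of steps is one more than [balance_arith] could ever permit. *)
have [X [F [C [cfg uX leX _ bal]]]] : exists X F C, [/\ config X F C,
    forall j, u j \in X j, \sum_j #|X j| <= r * ell,
    \sum_j #|X j| <= r + (r.-1 * (r * ell)).+1 * S &
    r * a.-1 * #|C| + r.-1 * a * \sum_j #|X j| + (r.-1 * (r * ell)).+1
      <= r * a.-1 * \sum_j #|F j| + r.-1 * a * r].
  elim: (_.+1) => [|i [X [F [C [cfg uX leX leXi bal]]]]].
    exists (fun j => [set u j]), (fun=> set0), set0.
    have sX : \sum_j #|[set u j]| = r.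
      by under eq_bigr do rewrite cards1; rewrite sum1_card cardJ.
    split; rewrite ?sX ?addn0 ?cards0 ?muln0 //=.
    - by move=> j f; rewrite inE.
    - by move=> j; rewrite inE.
    - by apply: leq_trans leS; apply: leq_addr.
    - exact: leq_addl.
  have [X' [F' [C' [cfg' uX' leX' bal']]]] := rich_step rich_u cfg uX leX.
  have := balance_arith (balance_lt cfg uX guz leX) bal.
  have [fits|full] := leqP (\sum_j #|X j| + S) (r * ell) => bnd.
    exists X', F', C'; split => //; first exact: leq_trans leX' fits.
      by rewrite mulSn; lia.
    by move: bal bal'; lia.
  exfalso.
  (* Lack of room for another step would mean [i < r.-1 * S], but by [leS] so few steps leave
     room. *)
  have h1 : i < r.-1 * S.
    have : r.-1 * (r * ell) < r.-1 * (\sum_j #|X j| + S).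
      by rewrite ltn_mul2l full andbT; lia.
    move: bnd; rewrite [r.-1 * (_ + S)]mulnDr.
    by move: (r.-1 * _) (r.-1 * (r * a)) (r.-1 * (r * ell)) (r.-1 * S); lia.
  have h2 : i.+1 * S <= r.-1 * S * S by rewrite leq_mul2r h1 orbT.
  by move: h2 leXi full leS; rewrite mulSn; lia.
have := balance_arith (balance_lt cfg uX guz leX) bal.
by move: (r.-1 * _) (r.-1 * (r * a)) (r.-1 * (r * ell)) => p p' p''; lia.
Qed.

(** As no tuple is rich, each [u] has a set [Z u] of at most [r * ell] tuples that meets every bad
    bunch at [u] in the second tuple of some leg; [g'] drops the edges into these sets in both
    directions. *)
Theorem sparse_deletion : exists g' : rel tup, [/\ symmetric g', subrel g' g,
  arcs g setT <= arcs g' setT + (r * ell * #|tup|).*2 &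
  forall u v qs, theta_legs g' a u v qs -> size qs = b -> False].
Proof.
have [Z ZP] : exists Z : tup -> {set tup}, forall u, #|Z u| <= r * ell /\
    forall v qs, bad_bunch u v qs -> has (fun q => leg_walk u v q 1 \in Z u) qs.
  apply: (@fin_all_exists tup (fun=> {set tup}) (fun u Z => #|Z| <= r * ell /\
    forall v qs, bad_bunch u v qs -> has (fun q => leg_walk u v q 1 \in Z) qs)).
  move=> u; apply: boolp.contrapT => none; apply: (@no_rich u) => Z leZ.
  apply: boolp.contrapT => none'; apply: none; exists Z; split=> // v qs bad.
  apply: boolp.contrapT => /negP/hasPn noZ; apply: none'; exists v, qs.
  by split=> // q /noZ.
pose g' x y := [&& g x y, y \notin Z x & x \notin Z y].
have g'_sub : subrel g' g by move=> x y /and3P[].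
exists g'; split => //.
- by move=> x y; rewrite /g' g_sym [(y \notin _) && _]andbC.
- have le1 x : degree g setT x <= degree g' setT x + (#|Z x| + #|[set y | x \in Z y]|).
    apply: (@leq_trans #|[set y in setT | g' x y] :|: (Z x :|: [set y | x \in Z y])|).
      apply: subset_leq_card; apply/subsetP => y; rewrite !inE /g' /= => ->.
      by case: (y \in Z x); case: (x \in Z y).
    apply: leq_trans (leq_card_setU _ _) _.
    by rewrite leq_add2l leq_card_setU.
  apply: (@leq_trans (\sum_(x in setT)
      (degree g' setT x + (#|Z x| + #|[set y | x \in Z y]|)))).
    by apply: leq_sum => x _; apply: le1.
  rewrite /arcs big_split /= leq_add2l big_split /=.
  have -> : \sum_(x in setT) #|[set y | x \in Z y]| = \sum_(x in setT) #|Z x|.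
    transitivity (\sum_(x in [set: tup]) \sum_(y in [set: tup]) (x \in Z y)).
      apply: eq_bigr => x _; rewrite -sum1_card [LHS]big_mkcond [RHS]big_mkcond /=.
      by apply: eq_bigr => y _; rewrite !inE; case: (x \in Z y).
    rewrite exchange_big; apply: eq_bigr => x _ /=.
    rewrite -sum1_card [LHS]big_mkcond [RHS]big_mkcond /=.
    by apply: eq_bigr => y _; rewrite !inE; case: (y \in Z x).
  rewrite addnn leq_double mulnC -cardsT -sum_nat_const.
  by apply: leq_sum => x _; case: (ZP x).
move=> u v qs th' sqs; have th := theta_legs_sub g'_sub th'.
have closed j := fun q => leg_closed (q := q) a_gt1 g_sym g_sub th j.
apply: (no_rich_theta th sqs) => j.
have [uv|uv] := eqVneq (u j) (v j); last first.
  have [|/(_ uv) + _] := closed_theta_gain (ltnW a_gt1) _ (closed j)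
    (uniq_firsts a_gt1 g_sub th j) (uniq_lasts a_gt1 g_sub th j).
    by rewrite sqs.
  by rewrite sqs.
(* One redundant leg is affordable here: the common end [u j = v j] counts as a single old vertex,
   out of an allowance of two. *)
have few : redundant a (leg_coord u v j) set0 qs <= 1.
  rewrite leqNgt; apply/negP => /(redundant_bunch th)[qs' sub bad].
  have [_ /(_ _ _ bad)/hasP[q qin qZ]] := ZP u.
  by have /and3P[_ /negP] := leg_adj a_gt1 th' (sub q qin) (ltnW a_gt1).
have FX : supported [set u j] set0 by move=> f; rewrite inE.
have cl : closed_family a (leg_coord u v j) [set u j] qs.
  by move=> q /(closed j)[nb -> ->]; rewrite -uv !inE.
have [_] := closed_family_gain (ltnW a_gt1) FX cl.
have := subset_leq_card (subsetUr [set u j] (Vof u v qs j)).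
rewrite cards0 set0U sqs cards1; slia.
Qed.

End NoSaving.
End TupleGraph.

(** * Theta graphs and Turan numbers *)

Lemma uniq_map_inj (T U : eqType) (f : T -> U) s :
  uniq (map f s) -> {in s &, injective f}.
Proof.
move=> um x y xs ys fxy.
have : nth (f x) (map f s) (index x s) = nth (f x) (map f s) (index y s).
  by rewrite !(nth_map x) ?index_mem // !nth_index.
move/eqP; rewrite nth_uniq ?size_map ?index_mem // => /eqP/(congr1 (nth x s)).
by rewrite !nth_index.
Qed.

Definition mk_edge (T : finType) (f : {set T}) (f2 : #|f| == 2) : edge T :=
  exist _ f f2.

Section Theta.
Variables (a b : nat).
Hypothesis a_gt1 : 1 < a.

Lemma theta_ptS (i : 'I_b) (k : 'I_a.-1) : theta_pt a i k.+1 = inr (i, k).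
Proof. by rewrite /theta_pt /= valK. Qed.

Lemma theta_pt_end (i : 'I_b) : theta_pt a i a = inl true.
Proof. by rewrite /theta_pt eqn0Ngt (ltnW a_gt1) /= insubF // ltnn. Qed.

Lemma theta_pt_inj (i : 'I_b) j j' : j <= a -> j' <= a ->
  theta_pt a i j = theta_pt a i j' -> j = j'.
Proof.
have code j0 : j0 <= a -> j0 = match theta_pt a i j0 with
    | inl false => 0 | inl true => a | inr (_, k) => k.+1 end.
  case: j0 => [//|j0] lej; have [lt|ge] := ltnP j0 a.-1.
    by rewrite (theta_ptS i (Ordinal lt)).
  have -> : j0.+1 = a by lia.
  by rewrite theta_pt_end.
by move=> /code{2}-> /code{2}-> ->.
Qed.

Lemma theta_pt_inr (i : 'I_b) l z : theta_pt a i l = inr z -> z.1 = i.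
Proof.
by rewrite /theta_pt; case: eqP => // _; case: (insub _) => // k [<-].
Qed.

Definition theta_edge (ij : 'I_b * 'I_a) : {set theta_vertex a b} :=
  [set theta_pt a ij.1 ij.2; theta_pt a ij.1 ij.2.+1].

Lemma theta_edge_card ij : #|theta_edge ij| == 2.
Proof.
rewrite cards2 eqSS eqb1; apply/eqP => /theta_pt_inj H.
by have := H (ltnW (ltn_ord _)) (ltn_ord _); lia.
Qed.

(** As [a > 1], every edge has an interior vertex, which reveals its leg; within a leg, positions
    are distinct. *)
Lemma theta_edge_inj : injective theta_edge.
Proof.
move=> [i j] [i' j'] eqE.
have inner (i0 : 'I_b) (j0 : 'I_a) :
    exists k : 'I_a.-1, inr (i0, k) \in theta_edge (i0, j0).
  case: j0 => [[|j0] lt0].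
    have lt1 : 0 < a.-1 by lia.
    by exists (Ordinal lt1); rewrite /theta_edge /= -theta_ptS !inE eqxx orbT.
  have lt1 : j0 < a.-1 by lia.
  by exists (Ordinal lt1); rewrite /theta_edge /= -theta_ptS !inE eqxx.
have ii : i = i'.
  have [k] := inner i j; rewrite eqE => /set2P[] /esym/theta_pt_inr //.
rewrite -ii in eqE *; congr pair; apply: val_inj => /=.
have mem j0 (l : nat) : l <= a ->
    theta_pt a i l \in theta_edge (i, j0) = (l == j0) || (l == j0.+1).
  move=> lea; rewrite !inE /=; congr orb; apply/eqP/eqP => [|->//];
    by apply: theta_pt_inj; rewrite // ltnW.
have h1 := mem j j (ltnW (ltn_ord j)); have h2 := mem j j.+1 (ltn_ord j).
move: h1 h2; rewrite eqE !mem ?(ltnW (ltn_ord j)) ?ltn_ord // !eqxx orbT /=.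
by move=> /orP[]/eqP h1 /orP[]/eqP h2; lia.
Qed.

Lemma thetaP (f : edge (theta_vertex a b)) :
  reflect (exists ij, val f = theta_edge ij) (f \in theta a b).
Proof.
rewrite inE; apply: (iffP existsP) => [[i /existsP[j /eqP->]]|[[i j] ->]].
  by exists (i, j).
by exists i; apply/existsP; exists j.
Qed.

Lemma card_theta : #|theta a b| = a * b.
Proof.
pose mk ij := mk_edge (theta_edge_card ij).
have mk_inj : injective mk by move=> x y /(congr1 val) /= /theta_edge_inj.
have -> : theta a b = [set mk ij | ij in setT].
  apply/setP => f; apply/thetaP/imsetP => [[ij fE]|[ij _ ->]]; last by exists ij.
  by exists ij => //; apply: val_inj.
by rewrite card_imset // cardsT card_prod !card_ord mulnC.
Qed.

Lemma card_theta_vertex : #|theta_vertex a b| = 2 + b * (a - 1).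
Proof. by rewrite card_sum card_bool card_prod !card_ord subn1. Qed.

Lemma bipartite_theta : bipartite (theta a b).
Proof.
pose side (z : theta_vertex a b) :=
  match z with inl false => false | inl true => odd a | inr (_, k) => ~~ odd k end.
have side_pt i j : j <= a -> side (theta_pt a i j) = odd j.
  case: j => [//|j] lej; have [lt|ge] := ltnP j a.-1.
    by rewrite (theta_ptS i (Ordinal lt)).
  by have -> : j.+1 = a; [lia|rewrite theta_pt_end].
apply/existsP; exists [set z | side z]; apply/forall_inP => f /thetaP[[i j] ->].
rewrite /theta_edge /=; set x := theta_pt a i j; set y := theta_pt a i j.+1.
have sx : side x = odd j by rewrite side_pt // ltnW.
have sy : side y = ~~ odd j by rewrite side_pt.
apply/cards1P; case: (boolP (odd j)) => oj; rewrite ?oj ?(negPf oj) in sx sy.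
  exists x; apply/setP => z; rewrite !inE.
  by case: eqP => [->|_] /=; [rewrite sx|case: eqP => // ->; rewrite sy].
exists y; apply/setP => z; rewrite !inE.
case: (z =P y) => [->|_]; first by rewrite sy orbT.
by rewrite orbF; case: eqP => // ->; rewrite sx.
Qed.

End Theta.

(** * Translation between edge sets and adjacency relations *)

Section Adjacency.
Variable T : finType.

Definition adjacent (G : {set edge T}) : rel T :=
  fun x y => [exists f in G, val f == [set x; y]].

Implicit Type G : {set edge T}.

Lemma adjacentP G x y :
  reflect (exists2 f, f \in G & val f = [set x; y]) (adjacent G x y).
Proof. exact: exists_eq_inP. Qed.

Lemma adjacent_sym G : symmetric (adjacent G).
Proof. by move=> x y; apply: eq_existsb => f; rewrite setUC. Qed.

Lemma adjacent_irr G : irreflexive (adjacent G).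
Proof.
move=> x; apply/negbTE/negP => /adjacentP[f _ fE].
by have := valP f; rewrite fE setUid cards1.
Qed.

Lemma arcs_adjacent G : arcs (adjacent G) setT = (#|G|).*2.
Proof.
have -> : arcs (adjacent G) setT = \sum_(x in [set: T]) \sum_(f in G) (x \in val f).
  apply: eq_bigr => x _.
  have -> : \sum_(f in G) (x \in val f) = #|[set f in G | x \in val f]|.
    rewrite -sum1_card big_mkcond [RHS]big_mkcond /=; apply: eq_bigr => f _.
    by rewrite inE; case: (f \in G); case: (x \in _).
  pose nb (f : edge T) := odflt x [pick y | val f == [set x; y]].
  have nbP (f : edge T) : x \in val f -> val f = [set x; nb f] /\ x != nb f.
    move=> xf; have : #|val f| == 2 := valP f.
    move=> /cards2P[y [z [yz fE]]].
    have [w fw] : exists w, val f = [set x; w].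
      move: xf; rewrite fE => /set2P[->|->]; first by exists z.
      by exists y; rewrite setUC.
    rewrite /nb; case: pickP => [w' /eqP fE'|/(_ w)]; last by rewrite fw eqxx.
    split=> //=; apply/eqP => xw; have := valP f.
    by rewrite fE' -xw setUid cards1.
  have nb_inj : {in [set f in G | x \in val f] &, injective nb}.
    move=> f f'; rewrite !inE => /andP[_ /nbP[fE _]] /andP[_ /nbP[fE' _]] eqn.
    by apply: val_inj; rewrite fE fE' eqn.
  rewrite -(card_in_imset nb_inj); apply: eq_card => y; rewrite !inE /=.
  apply/adjacentP/imsetP => [[f fG fE]|[f + ->]].
    have xf : x \in val f by rewrite fE !inE eqxx.
    exists f; first by rewrite inE fG.
    have [fE' xnb] := nbP f xf; move: fE'; rewrite fE => /setP/(_ (nb f)).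
    by rewrite !inE eqxx orbT eq_sym (negPf xnb) => /eqP.
  by rewrite inE => /andP[fG /nbP[fE _]]; exists f.
rewrite exchange_big /= -muln2 -sum_nat_const; apply: eq_bigr => f _.
transitivity #|val f|; last by apply/eqP; exact: (valP f).
rewrite -sum1_card [RHS]big_mkcond /=.
by apply: eq_big => [x|x _]; rewrite ?inE //; case: (x \in _).
Qed.

Definition graph_of (e : rel T) : {set edge T} :=
  [set f | [exists x, exists y, e x y && (val f == [set x; y])]].

Lemma adjacent_graph_of e : symmetric e -> irreflexive e ->
  adjacent (graph_of e) =2 e.
Proof.
move=> e_sym e_irr x y; apply/adjacentP/idP => [[f]|exy].
  rewrite inE => /existsP[x' /existsP[y' /andP[exy /eqP->]]].
  move/setP => eqf; have := eqf x; have := eqf y.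
  rewrite !inE !eqxx orbT /= => /orP[]/eqP y1 /orP[]/eqP x1; subst => //.
  - by have := eqf y'; rewrite !inE eqxx orbT => /esym/orP[]/eqP y'E;
      rewrite y'E e_irr in exy.
  - by rewrite e_sym.
  - by have := eqf x'; rewrite !inE eqxx => /esym/orP[]/eqP x'E;
      rewrite x'E e_irr in exy.
have xy : x != y by apply: contraTneq exy => ->; rewrite e_irr.
have c2 : #|[set x; y]| == 2 by rewrite cards2 xy.
exists (mk_edge c2); last by [].
by rewrite inE; apply/existsP; exists x; apply/existsP; exists y; rewrite exy /=.
Qed.

Lemma contains_legs a b G : 1 < a -> 0 < b -> contains (theta a b) G ->
  exists u v qs, theta_legs (adjacent G) a u v qs /\ size qs = b.
Proof.
move=> a_gt1 b_gt0 /existsP[phi /andP[/injectiveP phi_inj /forall_inP phiG]].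
pose leg (i : 'I_b) := [seq phi (inr (i, k)) | k <- enum 'I_a.-1].
exists (phi (inl false)), (phi (inl true)), [seq leg i | i <- enum 'I_b].
split; last by rewrite size_map size_enum_ord.
have leg_nth i s : s <= a ->
    nth (phi (inl false)) (phi (inl false) :: rcons (leg i) (phi (inl true))) s
    = phi (theta_pt a i s).
  case: s => [//|s] les; rewrite /= nth_rcons size_map size_enum_ord.
  have [lts|ges] := ltnP s a.-1.
    rewrite (nth_map (Ordinal lts)) ?size_enum_ord //.
    by rewrite (theta_ptS i (Ordinal lts)) (nth_ord_enum _ (Ordinal lts)).
  have -> : s = a.-1 by lia.
  by rewrite eqxx prednK ?theta_pt_end // ltnW.
apply/andP; split.
  apply/allP => _ /mapP[i _ ->]; rewrite size_map size_enum_ord eqxx /=.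
  apply/(pathP (phi (inl false))) => s; rewrite size_rcons size_map size_enum_ord.
  rewrite prednK ?(ltnW a_gt1) // => lts.
  have := leg_nth i s (ltnW lts); have := leg_nth i s.+1 lts => /= -> ->.
  pose f := mk_edge (theta_edge_card a_gt1 (i, Ordinal lts)).
  have /phiG/exists_inP[g gG /eqP gE] : f \in theta a b.
    by apply/thetaP; exists (i, Ordinal lts).
  apply/adjacentP; exists g => //; rewrite gE /=.
  by rewrite /theta_edge /= imsetU1 imset_set1.
pose L : seq (theta_vertex a b) := inl false :: inl true ::
  [seq inr (i, k) | i <- enum 'I_b, k <- enum 'I_a.-1].
have -> : phi (inl false) :: phi (inl true) :: flatten [seq leg i | i <- enum 'I_b]
    = map phi L.
  rewrite /L /= map_flatten -map_comp.
  congr (_ :: (_ :: flatten _)); apply: eq_map => i /=.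
  by rewrite /leg -map_comp.
rewrite map_inj_uniq //= !inE /=.
have no z : inl z \notin
      [seq inr (i, k) : theta_vertex a b | i <- enum 'I_b, k <- enum 'I_a.-1].
  by apply/allpairsP => -[[i k] []].
rewrite !no /=; apply: allpairs_uniq; rewrite ?enum_uniq //.
by move=> [i k] [i' k'] _ _ /= [-> ->].
Qed.

Lemma legs_contains a b G u v qs : 1 < a ->
  theta_legs (adjacent G) a u v qs -> size qs = b -> contains (theta a b) G.
Proof.
move=> a_gt1 /andP[/allP legs uq] sqs.
pose phi : {ffun theta_vertex a b -> T} := [ffun z : theta_vertex a b =>
  match z with inl false => u | inl true => v
             | inr (i, k) => nth u (nth [::] qs i) k end].
have leg_in (i : 'I_b) : nth [::] qs i \in qs by rewrite mem_nth // sqs.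
have leg_sz (i : 'I_b) : size (nth [::] qs i) = a.-1.
  by have /andP[/eqP] := legs _ (leg_in i).
have leg_nth (i : 'I_b) s : s <= a ->
    nth u (u :: rcons (nth [::] qs i) v) s = phi (theta_pt a i s).
  rewrite ffunE; case: s => [//|s] les; rewrite /= nth_rcons leg_sz.
  have [lts|ges] := ltnP s a.-1; first by rewrite (theta_ptS i (Ordinal lts)).
  have -> : s = a.-1 by lia.
  by rewrite eqxx prednK ?theta_pt_end // ltnW.
apply/existsP; exists phi; apply/andP; split.
  pose L : seq (theta_vertex a b) := inl false :: inl true ::
    [seq inr (i, k) | i <- enum 'I_b, k <- enum 'I_a.-1].
  have mapL : map phi L = u :: v :: flatten qs.
    rewrite /L /= !ffunE map_flatten -map_comp; congr (_ :: (_ :: flatten _)).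
    rewrite -[RHS](mkseq_nth [::]) /mkseq sqs -val_enum_ord -map_comp.
    apply: eq_map => i /=; rewrite -map_comp.
    rewrite -[RHS](mkseq_nth u) /mkseq leg_sz -val_enum_ord -map_comp.
    by apply: eq_map => k /=; rewrite ffunE.
  have inL z : z \in L.
    case: z => [[]|[i k]]; rewrite !inE //=.
    by apply/allpairsP; exists (i, k); rewrite !mem_enum.
  by apply/injectiveP => x y; apply: (uniq_map_inj (s := L)); rewrite ?mapL.
apply/forall_inP => f /thetaP[[i j] fE].
have /andP[_ /(pathP u) H] := legs _ (leg_in i).
have lts : j < size (rcons (nth [::] qs i) v) by rewrite size_rcons leg_sz prednK // ltnW.
have := H j lts; have := leg_nth i j (ltnW (ltn_ord j)).
have := leg_nth i j.+1 (ltn_ord j) => /= -> -> /adjacentP[g gG gE].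
apply/exists_inP; exists g => //.
by rewrite gE fE /theta_edge /= imsetU1 imset_set1.
Qed.

End Adjacency.

Lemma arcs_setT (T : finType) (e : rel T) :
  arcs e setT = \sum_x \sum_y e x y.
Proof.
rewrite /arcs; apply: eq_big => x; rewrite ?inE // => _.
by rewrite degree_sum; apply: eq_bigl => y; rewrite inE.
Qed.

Lemma theta_legs_map (T U : finType) (e : rel T) (e' : rel U) (f : T -> U) a u v qs :
  injective f -> (forall x y, e x y -> e' (f x) (f y)) ->
  theta_legs e a u v qs -> theta_legs e' a (f u) (f v) (map (map f) qs).
Proof.
move=> f_inj fe /andP[/allP legs uq]; apply/andP; split.
  apply/allP => _ /mapP[q /legs/andP[sq pq] ->]; rewrite size_map sq /=.
  by rewrite -map_rcons path_map; apply: sub_path pq.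
by rewrite -map_flatten -!map_cons map_inj_uniq.
Qed.

Lemma turan_theta a b (T : finType) (e : rel T) : 1 < a -> 0 < b ->
  symmetric e -> irreflexive e -> (turan #|T| (theta a b)).*2 < arcs e setT ->
  exists u v qs, theta_legs e a u v qs /\ size qs = b.
Proof.
move=> a_gt1 b_gt0 e_sym e_irr lt.
pose f : 'I_#|T| -> T := enum_val.
pose e' i j := e (f i) (f j).
have e'_sym : symmetric e' by move=> x y; apply: e_sym.
have e'_irr : irreflexive e' by move=> x; apply: e_irr.
have arcsE : arcs e setT = arcs e' setT.
  rewrite !arcs_setT (reindex f) /=; last exact: onW_bij (enum_val_bij T).
  apply: eq_bigr => i _; rewrite (reindex f) //; exact: onW_bij (enum_val_bij T).
have adjE := adjacent_graph_of e'_sym e'_irr.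
have cG : arcs e' setT = (#|graph_of e'|).*2.
  rewrite -arcs_adjacent !arcs_setT.
  by apply: eq_bigr => x _; apply: eq_bigr => y _; rewrite adjE.
have : contains (theta a b) (graph_of e').
  apply: contraLR lt => free; rewrite arcsE cG -leqNgt leq_double.
  by rewrite /turan (bigD1 (graph_of e')) //= leq_maxl.
case/(contains_legs a_gt1 b_gt0) => u [v [qs [th sqs]]].
exists (f u), (f v), (map (map f) qs); rewrite size_map; split=> //.
apply: theta_legs_map th; first exact: enum_val_inj.
by move=> x y; rewrite adjE.
Qed.

Lemma turan_theta_upper a b : 1 < a -> exists C, forall n,
  turan n (theta a b) ^ a <= C * n ^ a.+1.
Proof.
move=> a_gt1; have [C CP] := theta_free_arcs b (ltnW a_gt1); exists C => n.
rewrite /turan; elim/big_ind: _ => [|x y|G free].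
- by rewrite exp0n // ltnW.
- by rewrite /maxn; case: ifP.
have := CP _ _ (adjacent_sym G) (adjacent_irr G).
rewrite card_ord arcs_adjacent => H; apply: leq_trans (H _).
  by rewrite leq_exp2r ?(ltnW a_gt1) // -addnn leq_addr.
move=> u v qs th; rewrite ltnNge; apply: contra free => le_b.
apply: (@legs_contains _ a b G u v (take b qs)) => //; last first.
  by rewrite size_takel.
apply: (theta_legs_subset a_gt1 th); last exact: mem_take.
by rewrite take_uniq // (theta_legs_uniq a_gt1 th).
Qed.

(** All edges of a star share a vertex, while the first and third edges of a leg are disjoint; the
    third exists as [2 < a]. *)
Lemma turan_theta_star n a b : 2 < a -> 0 < b -> n.-1 <= turan n (theta a b).
Proof.
move=> a_gt2 b_gt0; case: n => [//|n] /=.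
pose G : {set edge 'I_n.+1} := [set f : edge 'I_n.+1 | ord0 \in val f].
have nG : ~~ contains (theta a b) G.
  apply/negP => /existsP[phi /andP[/injectiveP phi_inj /forall_inP phiG]].
  have a_gt1 := ltnW a_gt2; pose i0 := Ordinal b_gt0.
  have root (j : 'I_a) : exists2 z, z \in theta_edge (i0, j) & phi z = ord0.
    have /phiG/exists_inP[g] : mk_edge (theta_edge_card a_gt1 (i0, j)) \in theta a b.
      by apply/thetaP; exists (i0, j).
    by rewrite inE => g0 /eqP gE; move: g0; rewrite gE => /imsetP[z ? ->]; exists z.
  have [x xE px] := root (Ordinal (ltnW a_gt1)).
  have [y yE py] := root (Ordinal a_gt2).
  have xy : x = y by apply: phi_inj; rewrite px.
  rewrite -{}xy in yE; move: xE yE; rewrite /theta_edge !inE /=.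
  by move=> /orP[]/eqP-> /orP[]/eqP/theta_pt_inj H; have := H a_gt1; lia.
apply: leq_trans (_ : #|G| <= _); last by rewrite /turan (bigD1 G) //= leq_maxl.
have nz (i : 'I_n) : #|[set ord0; lift ord0 i]| == 2 by rewrite cards2 neq_lift.
pose f i : edge 'I_n.+1 := mk_edge (nz i).
have f_inj : injective f.
  move=> i j /(congr1 val) /= /setP/(_ (lift ord0 i)).
  rewrite !inE eqxx orbT [_ == ord0]eq_sym (negPf (neq_lift _ _)) /=.
  by move/esym/eqP/lift_inj.
rewrite -[X in X <= _]card_ord -(card_imset _ f_inj); apply: subset_leq_card.
by apply/subsetP => _ /imsetP[i _ ->]; rewrite !inE eqxx.
Qed.

(** * Monochromatic matchings and the coloring condition *)

Section Coloring.
Variables (n k : nat) (c : {ffun edge 'I_n -> 'I_k}).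
Lemma card_edges_in (S : {set 'I_n}) :
  #|[set f : edge 'I_n | val f \subset S]| = 'C(#|S|, 2).
Proof.
rewrite -cards_draws -(card_imset _ val_inj); apply: eq_card => f.
rewrite inE; apply/imsetP/andP => [[g + ->]|[fS f2]].
  by rewrite inE => gS; split=> //; apply: (valP g).
by exists (mk_edge f2); rewrite ?inE.
Qed.

(** Greedy: discarding the edges that meet a chosen one loses at most [2 * D]. *)
Lemma matching D m (M : {set edge 'I_n}) : 0 < D ->
    (forall x, #|[set f in M | x \in val f]| <= D) -> 2 * D * m <= #|M| ->
  exists es : seq (edge 'I_n), [/\ size es = m, {subset es <= M}
    & pairwise (fun f g : edge 'I_n => [disjoint val f & val g]) es].
Proof.
move=> D_gt0; elim: m M => [|m IH] M degM leM; first by exists [::].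
have /card_gt0P[f fM] : 0 < #|M| by nia.
have /cards2P[x [y [xy fE]]] : #|val f| == 2 := valP f.
pose M1 := [set g in M | [disjoint val f & val g]].
have sM1 : M1 \subset M by apply/subsetP => g; rewrite inE => /andP[].
have [||es [ses sub pw]] := IH M1.
- move=> z; apply: leq_trans (degM z); apply: subset_leq_card.
  by apply/subsetP => g; rewrite !inE => /andP[/andP[-> _] ->].
- have : #|M| <= #|M1| + (D + D).
    apply: (@leq_trans #|M1 :|: ([set g in M | x \in val g] :|: [set g in M | y \in val g])|).
      apply: subset_leq_card; apply/subsetP => g gM; rewrite !inE gM /=.
      case: (boolP [disjoint _ & _]) => //=; rewrite -setI_eq0 => /set0Pn[z].
      by rewrite inE fE => /andP[/set2P[]-> ->]; rewrite ?orbT.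
    apply: leq_trans (leq_card_setU _ _) _; rewrite leq_add2l.
    by apply: leq_trans (leq_card_setU _ _) _; apply: leq_add.
  by move: leM; nia.
exists (f :: es); split => /=; first by rewrite ses.
  by move=> g; rewrite inE => /predU1P[->//|/sub/(subsetP sM1)].
rewrite pw andbT; apply/allP => g /sub; rewrite inE => /andP[_] //.
Qed.

(** While enough edges are left, some color still has [2 * D * w] of them, and [matching] cuts one
    more block out of it. *)
Lemma blocks D w h : 0 < D -> 0 < w ->
    (forall x g, #|[set f : edge 'I_n | (x \in val f) && (c f == g)]| <= D) ->
    h * w + k * (2 * D * w) <= 'C(n, 2) ->
  exists bl : seq (seq (edge 'I_n)), [/\ size bl = h, uniq (flatten bl)
    & forall es, es \in bl -> [/\ size es = w,
        pairwise (fun f g : edge 'I_n => [disjoint val f & val g]) es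
        & exists g, forall f, f \in es -> c f = g]].
Proof.
move=> D_gt0 w_gt0 degc; elim: h => [|h IH] leh; first by exists [::].
have [|bl [sbl ubl blP]] := IH; first by move: leh; rewrite mulSn; lia.
pose R : {set edge 'I_n} := ~: [set f in flatten bl].
have sfl : size (flatten bl) = h * w.
  rewrite size_flatten /shape -sbl; elim: (bl) blP => //= es l IHl blP.
  have [-> _ _] := blP es (mem_head _ _); rewrite mulSn IHl // => es' es'l.
  by apply: blP; rewrite inE es'l orbT.
have cR : h * w + #|R| = 'C(n, 2).
  have := cardsC [set f in flatten bl].
  rewrite cardsE (card_uniqP ubl) sfl => ->.
  have := card_edges_in setT; rewrite cardsT card_ord => <-.
  by apply: eq_card => f; rewrite !inE subsetT.
have [g lg] : exists g, 2 * D * w <= #|[set f in R | c f == g]|.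
  apply/existsP; apply: contraLR leh; rewrite negb_exists => /forallP small.
  rewrite -ltnNge -cR mulSn.
  have : #|R| <= k * (2 * D * w).
    rewrite -[X in X * _]card_ord -sum_nat_const.
    have -> : #|R| = \sum_(g : 'I_k) #|[set f in R | c f == g]|.
      rewrite -sum1_card (partition_big c predT) //=; apply: eq_bigr => g _.
      by rewrite -sum1_card; apply: eq_bigl => f; rewrite !inE.
    by apply: leq_sum => g _; apply: ltnW; rewrite ltnNge small.
  by move: w_gt0; lia.
have degR x : #|[set f in [set f in R | c f == g] | x \in val f]| <= D.
  apply: leq_trans (degc x g); apply: subset_leq_card; apply/subsetP => f.
  by rewrite !inE => /andP[/andP[_ ->] ->].
have [es [ses sub pw]] := matching D_gt0 degR lg.
exists (es :: bl); split => /=; first by rewrite sbl.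
  have ues : uniq es.
    apply: pairwise_uniq pw => f; apply/negbTE; rewrite -setI_eq0 setIid.
    by rewrite -card_gt0; have /eqP-> : #|val f| == 2 := valP f.
  rewrite cat_uniq ues ubl andbT /=; apply/hasPn => f fbl.
  by apply/negP => /sub; rewrite !inE fbl.
move=> es'; rewrite inE => /predU1P[->|/blP//]; split => //.
by exists g => f /sub; rewrite inE => /andP[_ /eqP].
Qed.

Variables (p X0 : nat).
Hypothesis lepn : p <= n.
Hypothesis cP : pq_coloring p ('C(p, 2) - X0 + 1) c.

(** Enlarge [U] to [p] vertices; the edges outside [E] contribute at most one color each. *)
Lemma few_colors (E : {set edge 'I_n}) (U : {set 'I_n}) :
  (forall f, f \in E -> val f \subset U) -> #|U| <= p ->
  #|E| < #|c @: E| + X0.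
Proof.
move=> EU leU.
have [S US cS] : exists2 S : {set 'I_n}, U \subset S & #|S| = p.
  have /card_gt0P[W] : 0 < #|[set W : {set 'I_n} | W \subset ~: U & #|W| == p - #|U|]|.
    by rewrite cards_draws bin_gt0 [#|~: U|]cardsCs setCK card_ord leq_sub2r.
  rewrite inE => /andP[WU /eqP cW]; exists (U :|: W); first exact: subsetUl.
  rewrite cardsU (_ : U :&: W = set0) ?cards0 ?subn0 ?cW ?subnKC //.
  by apply/setP => z; rewrite !inE; case Uz: (z \in U) => //=;
    apply/negP => /(subsetP WU); rewrite inE Uz.
pose ES := [set f : edge 'I_n | val f \subset S].
have sE : E \subset ES by apply/subsetP => f /EU fU; rewrite inE (subset_trans fU).
have := forallP cP S; rewrite cS eqxx /= => leq_.
have le1 : #|[set c e | e : edge 'I_n & val e \subset S]| <= #|c @: E| + #|ES :\: E|.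
  apply: leq_trans (_ : #|c @: E :|: c @: (ES :\: E)| <= _); last first.
    by apply: leq_trans (leq_card_setU _ _) _; rewrite leq_add2l leq_imset_card.
  apply: subset_leq_card; apply/subsetP => _ /imsetP[f + ->].
  rewrite inE => fS; apply/setUP; case: (boolP (f \in E)) => fE.
    by left; apply: imset_f.
  by right; apply: imset_f; rewrite 2!inE fE.
have := cardsID E ES; rewrite setIC (setIidPl sE) card_edges_in cS => cE.
by move: (leq_trans leq_ le1); clear -cE; slia.
Qed.

(** Otherwise [p - 1] edges at [x] would span at most [p] vertices with a single color, against
    [few_colors]. *)
Lemma color_degree x g : X0 <= p - 2 -> 1 < p ->
  #|[set f : edge 'I_n | (x \in val f) && (c f == g)]| <= p.
Proof.
move=> leX p_gt1; rewrite leqNgt; apply/negP => lt.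
set D := [set f | _] in lt.
have [E [sE cE]] : exists E : {set edge 'I_n}, E \subset D /\ #|E| = p.-1.
  have /card_gt0P[W] : 0 < #|[set W : {set edge 'I_n} | W \subset D & #|W| == p.-1]|.
    by rewrite cards_draws bin_gt0 (leq_trans (leq_pred _) (ltnW lt)).
  by rewrite inE => /andP[? /eqP]; exists W.
have DP f : f \in E -> x \in val f /\ c f = g.
  by move=> /(subsetP sE); rewrite inE => /andP[? /eqP].
have sub f : f \in E -> val f \subset \bigcup_(f in E) val f.
  by move=> fE; apply: bigcup_sup.
have leU : #|\bigcup_(f in E) val f| <= p.
  have -> : \bigcup_(f in E) val f =
      x |: \bigcup_(f in E) (val f :\ x).
    apply/setP => z; rewrite !inE; apply/bigcupP/orP => [[f fE zf]|[/eqP->|]].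
    - case: (eqVneq z x) => [|zx]; [by left|right; apply/bigcupP; exists f => //].
      by rewrite !inE zx.
    - have /card_gt0P[f fE] : 0 < #|E| by rewrite cE; lia.
      by exists f => //; case: (DP f fE).
    - by case/bigcupP => f fE; rewrite !inE => /andP[_ zf]; exists f.
  rewrite cardsU1; apply: (@leq_trans (1 + p.-1)); last lia.
  apply: leq_add; first by case: (_ \notin _).
  rewrite -cE -[X in _ <= X]sum1_card; elim/big_rec2: _ => [|f m A fE leA]; first by rewrite cards0.
  apply: leq_trans (leq_card_setU _ _) _; apply: leq_add leA.
  have [xf _] := DP f fE; have : #|val f| == 2 := valP f.
  by rewrite (cardsD1 x) xf add1n eqSS => /eqP ->.
have := few_colors sub leU; have : #|c @: E| <= 1.
  rewrite -[X in _ <= X](cards1 g); apply: subset_leq_card; apply/subsetP => _ /imsetP[f fE ->].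
  by rewrite inE; have [_ ->] := DP f fE.
by rewrite cE; move: leX p_gt1; clear; slia.
Qed.

End Coloring.

(** * From colorings to color energy graphs *)

Lemma flatten_block_inj (T : eqType) (bl : seq (seq T)) x i j :
  uniq (flatten bl) -> x \in nth [::] bl i -> x \in nth [::] bl j -> i = j.
Proof.
elim: bl i j => [|l bl IH] [|i] [|j] //=; rewrite cat_uniq => /and3P[_ /hasPn dis ubl].
- move=> xl xj; have : x \in flatten bl.
    apply/flattenP; exists (nth [::] bl j) => //; apply: mem_nth.
    by rewrite ltnNge; apply: contraL xj => /(nth_default [::])->.
  by move/dis; rewrite /= xl.
- move=> xi xl; have : x \in flatten bl.
    apply/flattenP; exists (nth [::] bl i) => //; apply: mem_nth.
    by rewrite ltnNge; apply: contraL xi => /(nth_default [::])->.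
  by move/dis; rewrite /= xl.
- by move=> xi xj; congr _.+1; apply: IH ubl xi xj.
Qed.

Section Blocks.
Variables (n k h r t : nat) (c : {ffun edge 'I_n -> 'I_k}).

(** Block [l] is a monochromatic matching cut into [r] parts of [t] edges, one part for each
    coordinate. Distinct blocks may share a color; the color energy graph is labelled by blocks. *)
Definition block_family (Eb : 'I_h -> 'I_r -> 'I_t -> edge 'I_n) :=
  [/\ forall l i s l' i' s', Eb l i s = Eb l' i' s' -> [/\ l = l', i = i' & s = s'],
      forall l i s i' s', (i, s) != (i', s') ->
        [disjoint val (Eb l i s) & val (Eb l i' s')]
    & forall l, exists g, forall i s, c (Eb l i s) = g].

Lemma block_familyP (bl : seq (seq (edge 'I_n))) : size bl = h -> uniq (flatten bl) ->
  (forall es, es \in bl -> [/\ size es = r * t,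
        pairwise (fun f g : edge 'I_n => [disjoint val f & val g]) es
        & exists g, forall f, f \in es -> c f = g]) ->
  exists Eb, block_family Eb.
Proof.
move=> sbl ubl blP.
have inb (l : 'I_h) : nth [::] bl l \in bl by rewrite mem_nth ?sbl.
have lt_rt (i : 'I_r) (s : 'I_t) : i * t + s < r * t.
  by have := ltn_ord i; have := ltn_ord s; nia.
(* Each entry serves as its own default in [nth], since [edge 'I_n] may be empty. *)
have [f fP] : exists f : 'I_h * 'I_r * 'I_t -> edge 'I_n, forall x,
    f x = nth (f x) (nth [::] bl x.1.1) (x.1.2 * t + x.2).
  apply: (@fin_all_exists ('I_h * 'I_r * 'I_t)%type (fun=> edge 'I_n) (fun x e => e =
    nth e (nth [::] bl x.1.1) (x.1.2 * t + x.2))) => -[[l i] s] /=.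
  have [ses _ _] := blP _ (inb l).
  case E: (nth [::] bl l) ses (lt_rt i s) => [|e0 es] /= ses lt.
    by rewrite -ses in lt.
  exists (nth e0 (e0 :: es) (i * t + s)); apply: set_nth_default.
  by rewrite /= ses.
have f_in x : f x \in nth [::] bl x.1.1.
  case: x => [[l i] s]; rewrite fP mem_nth //=.
  by have [-> _ _] := blP _ (inb l).
have sz (l : 'I_h) : size (nth [::] bl l) = r * t by have [] := blP _ (inb l).
have ind_inj (i i' : 'I_r) (s s' : 'I_t) : i * t + s = i' * t + s' -> i = i' /\ s = s'.
  move=> eqi; have t_gt0 : 0 < t by apply: leq_ltn_trans (ltn_ord s).
  have := congr1 (divn^~ t) eqi; have := congr1 (modn^~ t) eqi.
  rewrite !divnMDl // !modnMDl !(divn_small (ltn_ord _)) !addn0.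
  by rewrite !modn_small //; split; apply: val_inj.
exists (fun l i s => f (l, i, s)); split.
- move=> l i s l' i' s' eqf.
  have ll : l = l'.
    apply: val_inj; apply: (flatten_block_inj (x := f (l, i, s))) ubl (f_in (l, i, s)) _.
    by rewrite eqf; apply: (f_in (l', i', s')).
  subst l'; move: (eqf); rewrite (fP (l, i, s)) (fP (l, i', s')) eqf /=.
  move/eqP; rewrite nth_uniq ?sz //; first by move/eqP/ind_inj => [-> ->].
  have [_ pw _] := blP _ (inb l); apply: pairwise_uniq pw => e.
  apply/negbTE; rewrite -setI_eq0 setIid.
  by rewrite -card_gt0; have /eqP-> : #|val e| == 2 := valP e.
- move=> l i s i' s' neq; have [_ pw _] := blP _ (inb l).
  have dis (i1 : 'I_r) (s1 : 'I_t) (i2 : 'I_r) (s2 : 'I_t) : i1 * t + s1 < i2 * t + s2 ->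
      [disjoint val (f (l, i1, s1)) & val (f (l, i2, s2))].
    move=> lt; rewrite (fP (l, i1, s1)) (fP (l, i2, s2)) /=.
    move: lt (lt_rt i2 s2); rewrite -(sz l) => lt lt2.
    have /(pairwiseP (f (l, i1, s1))) H := pw.
    have := H (i1 * t + s1) (i2 * t + s2) (ltn_trans lt lt2) lt2 lt.
    by rewrite (set_nth_default (f (l, i2, s2)) (f (l, i1, s1)) lt2).
  case: (ltngtP (i * t + s) (i' * t + s')) => [/dis//|/dis|/ind_inj [ii ss]].
    by rewrite disjoint_sym.
  by rewrite ii ss eqxx in neq.
- move=> l; have [_ _ [g gP]] := blP _ (inb l); exists g => i s.
  exact: gP (f_in (l, i, s)).
Qed.

Variable Eb : 'I_h -> 'I_r -> 'I_t -> edge 'I_n.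
Hypothesis EbP : block_family Eb.

Definition block_rel (l : 'I_h) (i : 'I_r) : rel 'I_n :=
  fun x y => [exists s, val (Eb l i s) == [set x; y]].

Lemma block_sym l i : symmetric (block_rel l i).
Proof. by move=> x y; apply: eq_existsb => s; rewrite setUC. Qed.

Lemma block_irr l i : irreflexive (block_rel l i).
Proof.
move=> x; apply/negbTE; rewrite negb_exists; apply/forallP => s.
apply/eqP => E; have : #|val (Eb l i s)| == 2 := valP (Eb l i s).
by rewrite E setUid cards1.
Qed.

Lemma block_fun l i x y y' : block_rel l i x y -> block_rel l i x y' -> y = y'.
Proof.
move=> xy xy'; have nxy : x != y by apply: contraTneq xy => ->; rewrite block_irr.
case/existsP: xy => s /eqP E; case/existsP: xy' => s' /eqP E'.
have [_ dis _] := EbP; have := dis l i s i s'.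
rewrite xpair_eqE eqxx /=; case: (eqVneq s s') => [ss _|_ /(_ isT)].
  by move/setP/(_ y): E'; rewrite -ss E !inE eqxx orbT eq_sym (negPf nxy) => /esym/eqP.
by rewrite E E' -setI_eq0 => /eqP/setP/(_ x); rewrite !inE eqxx.
Qed.

Lemma block_inj l l' i i' x y :
  block_rel l i x y -> block_rel l' i' x y -> l = l' /\ i = i'.
Proof.
move=> /existsP[s /eqP E] /existsP[s' /eqP E'].
have [inj _ _] := EbP; have := inj l i s l' i' s'.
by case=> [|-> -> _]; first by apply: val_inj; rewrite E E'.
Qed.

(** Edges in different coordinates are distinct, so none is counted twice, and a block determines
    its color, so there are at most [#|C|] colors. Overlaps of the sets [X j] only lower the number
    of vertices. *)
Lemma block_no_saving p X0 X F C : p <= n ->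
  pq_coloring p ('C(p, 2) - X0 + 1) c -> config block_rel X F C ->
  \sum_j #|X j| <= p -> \sum_j #|F j| < #|C| + X0.
Proof.
move=> lepn cP cfg leX.
pose E := [set e : edge 'I_n | [exists j, val e \in F j]].
have leE : \sum_j #|F j| <= #|E|.
  have le1 j : #|F j| <= #|[set e : edge 'I_n | val e \in F j]|.
    rewrite -[X in _ <= X](card_imset _ val_inj); apply: subset_leq_card; apply/subsetP => f fF.
    have [_ [l _ /hueP[x [y [fE xy]]]]] := cfg j f fF.
    have f2 : #|f| == 2.
      rewrite fE cards2 (_ : x != y) //.
      by apply: contraTneq xy => ->; rewrite block_irr.
    by apply/imsetP; exists (mk_edge f2); rewrite ?inE.
  apply: (@leq_trans (\sum_j #|[set e : edge 'I_n | val e \in F j]|)).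
    by apply: leq_sum => j _; apply: le1.
  have -> : \sum_j #|[set e : edge 'I_n | val e \in F j]|
          = \sum_(e : edge 'I_n) \sum_j (val e \in F j).
    rewrite exchange_big; apply: eq_bigr => j _.
    rewrite -sum1_card [LHS]big_mkcond; apply: eq_bigr => e _ /=.
    by rewrite inE; case: (_ \in _).
  rewrite -sum1_card [X in _ <= X]big_mkcond; apply: leq_sum => e _ /=.
  rewrite inE; case: existsP => [[j ej]|none]; last first.
    by rewrite big1 // => j _; apply/eqP; rewrite eqb0; apply/negP => ej;
      case: none; exists j.
  rewrite (bigD1 j) //= ej big1 // => j' nj; apply/eqP; rewrite eqb0.
  apply: contra nj => ej'.
  have [_ [l _ /hueP[x [y [fE xy]]]]] := cfg j _ ej.
  have [_ [l' _ hl']] := cfg j' _ ej'.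
  have [x' [y' [fE' xy']]] := hueP hl'.
  case/existsP: xy => s /eqP Es; case/existsP: xy' => s' /eqP Es'.
  have [inj _ _] := EbP; have := inj l' j' s' l j s.
  by case=> [|_ -> _ //]; apply: val_inj; rewrite Es Es' -fE -fE'.
have [g gP] : exists g : 'I_h -> 'I_k, forall l i s, c (Eb l i s) = g l.
  have [_ _ col] := EbP.
  exact: (@fin_all_exists 'I_h (fun=> 'I_k) (fun l g => forall i s, c (Eb l i s) = g) col).
have leC : #|c @: E| <= #|C|.
  apply: leq_trans (leq_imset_card g C); apply: subset_leq_card.
  apply/subsetP => _ /imsetP[e + ->]; rewrite inE => /existsP[j ej].
  have [_ [l lC /hueP[x [y [fE /existsP[s /eqP Es]]]]]] := cfg j _ ej.
  have -> : e = Eb l j s by apply: val_inj; rewrite fE Es.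
  by rewrite gP imset_f.
have EX e : e \in E -> val e \subset \bigcup_j X j.
  rewrite inE => /existsP[j ej]; have [eX _] := cfg j _ ej.
  exact: subset_trans eX (bigcup_sup _ _).
have leU : #|\bigcup_j X j| <= p.
  apply: leq_trans leX; elim/big_rec2: _ => [|j m A _ leA]; first by rewrite cards0.
  by apply: leq_trans (leq_card_setU _ _) _; rewrite leq_add2l.
have := few_colors lepn cP EX leU.
by move: leE leC; clear; slia.
Qed.

(** A block and a choice of one of its [t] edges in each coordinate give an arc, once an orientation
    of every edge is fixed. *)
Lemma block_arcs : 0 < r -> h * t ^ r <= arcs (energy_rel block_rel) setT.
Proof.
move=> r_gt0.
have [f fP] : exists f : 'I_h * 'I_r * 'I_t -> 'I_n * 'I_n,
    forall x, val (Eb x.1.1 x.1.2 x.2) = [set (f x).1; (f x).2].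
  apply: (@fin_all_exists ('I_h * 'I_r * 'I_t)%type (fun=> ('I_n * 'I_n)%type) (fun x u =>
    val (Eb x.1.1 x.1.2 x.2) = [set u.1; u.2])) => -[[l i] s] /=.
  have : #|val (Eb l i s)| == 2 := valP (Eb l i s).
  by move=> /cards2P[x [y [_ ->]]]; exists (x, y).
pose T := tup 'I_n 'I_r.
pose mk (z : 'I_h * {ffun 'I_r -> 'I_t}) : T * T :=
  ([ffun i => (f (z.1, i, z.2 i)).1], [ffun i => (f (z.1, i, z.2 i)).2]).
have mk_inj : injective mk.
  move=> [l u] [l' u'] /pair_equal_spec[/ffunP e1 /ffunP e2].
  have same i : l = l' /\ u i = u' i.
    have [inj _ _] := EbP; have := inj l i (u i) l' i (u' i).
    case=> [|-> _ -> //]; apply: val_inj.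
    have := e1 i; have := e2 i; rewrite !ffunE /= => e2' e1'.
    by rewrite (fP (l, i, u i)) (fP (l', i, u' i)) e1' e2'.
  have [-> _] := same (Ordinal r_gt0); congr pair; apply/ffunP => i.
  by have [] := same i.
have -> : arcs (energy_rel block_rel) setT =
    #|[set z : T * T | energy_rel block_rel z.1 z.2]|.
  rewrite arcs_setT pair_big /= -sum1_card big_mkcond [RHS]big_mkcond /=.
  by apply: eq_bigr => z _; rewrite inE; case: energy_rel.
have -> : h * t ^ r = #|[set mk z | z in setT]|.
  by rewrite card_imset // cardsT card_prod card_ffun !card_ord.
apply: subset_leq_card; apply/subsetP => _ /imsetP[[l u] _ ->]; rewrite inE.
apply/existsP; exists l; apply/forallP => i; apply/existsP; exists (u i).
by rewrite !ffunE (fP (l, i, u i)).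
Qed.

End Blocks.

(** * The energy graph against the Turan number *)

Section Core.
Variables (n k a b r h t : nat) (c : {ffun edge 'I_n -> 'I_k}).
Let ell := 2 + b * a.-1.
Hypotheses (r_gt1 : 1 < r) (ltra : r < a) (b_gt1 : 1 < b) (t_gt0 : 0 < t).
Hypothesis le_n : r * ell <= n.
Hypothesis cP :
  pq_coloring (r * ell) ('C(r * ell, 2) - r.-1 * (a * b) + 1) c.
Hypothesis le_ht : h * (r * t) + k * (2 * (r * ell) * (r * t)) <= 'C(n, 2).

Let a_gt1 : 1 < a. Proof. exact: ltn_trans ltra. Qed.

(** [host] is what the three cases of [b] have in common: a graph of large minimum degree loses at
    most [K] arcs per tuple on being freed of theta graphs with [bb] legs. *)
Lemma core_bound (bb : nat) K : 0 < bb ->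
  (forall (V B J : finType) (lb : B -> J -> rel V), #|J| = r ->
    (forall c j, symmetric (lb c j)) -> (forall c j, irreflexive (lb c j)) ->
    (forall c j x y y', lb c j x y -> lb c j x y' -> y = y') ->
    (forall c c' j j' x y, lb c j x y -> lb c' j' x y -> c = c' /\ j = j') ->
    forall g : rel (tup V J), symmetric g -> subrel g (energy_rel lb) ->
    (forall x y, g x y -> r * ell < degree g setT x) ->
    (forall X F C, config lb X F C -> \sum_j #|X j| <= r * ell ->
       \sum_j #|F j| < #|C| + r.-1 * (a * b)) ->
    exists g' : rel (tup V J), [/\ symmetric g', subrel g' g,
      arcs g setT <= arcs g' setT + K * #|tup V J| &
      forall u v qs, theta_legs g' a u v qs -> size qs = bb -> False]) ->
  h * t ^ r <= (turan (n ^ r) (theta a bb)).*2 + ((r * ell).+1.*2 + K) * n ^ r.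
Proof.
move=> bb_gt0 host.
(* Follows from [r < a]; it lets [color_degree] bound the color degrees by [r * ell]. *)
have leX0 : r.-1 * (a * b) <= r * ell - 2.
  have h1 : r.-1 * (a * b) + a * b = r * (a * b).
    by rewrite addnC -mulSn prednK // ltnW.
  have h2 : r * (b * a.-1) + r * b = r * (a * b).
    by rewrite -mulnDr addnC -mulnS prednK ?(mulnC b) // ltnW.
  have h3 : r * b <= a * b by rewrite leq_mul2r (ltnW ltra) orbT.
  by rewrite /ell mulnDr; lia.
have p_gt1 : 1 < r * ell by rewrite (leq_trans r_gt1) // leq_pmulr.
have degc x g := color_degree le_n cP x g leX0 p_gt1.
have rt_gt0 : 0 < r * t by rewrite muln_gt0 t_gt0 ltnW.
have [bl [sbl ubl blP]] := blocks (ltnW p_gt1) rt_gt0 degc le_ht.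
have [Eb EbP] := block_familyP sbl ubl blP.
pose e := energy_rel (block_rel Eb).
have e_sym : symmetric e := energy_sym (block_sym Eb).
have [W [_ degW arcW]] := min_degree_subset e_sym (r * ell).+1 setT.
pose g x y := [&& e x y, x \in W & y \in W].
have g_sym : symmetric g.
  by move=> x y; rewrite /g e_sym [(x \in W) && _]andbC.
have g_sub : subrel g e by move=> x y /and3P[].
have degE x : x \in W -> degree g setT x = degree e W x.
  by move=> Wx; apply: eq_card => y; rewrite !inE /g Wx /= andbC.
have g_deg x y : g x y -> r * ell < degree g setT x.
  by case/and3P => _ Wx _; rewrite degE // degW.
have arcg : arcs g setT = arcs e W.
  rewrite /arcs [LHS](bigID (mem W)) /= [X in _ + X]big1 ?addn0 => [|x].
    by apply: eq_big => [x|x Wx]; rewrite ?inE // degE //; case/andP: Wx.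
  rewrite inE /= => nW; apply: eq_card0 => y; rewrite !inE /g.
  by rewrite (negPf nW) andbF.
have [g' [g'_sym g'_sub leg free]] := host _ _ _ _ (card_ord r) (block_sym Eb)
  (block_irr Eb) (block_fun EbP) (block_inj EbP) g g_sym g_sub g_deg
  (fun X F C => block_no_saving EbP le_n cP).
have cN : #|tup 'I_n 'I_r| = n ^ r by rewrite card_ffun !card_ord.
have g'_irr : irreflexive g'.
  move=> x; apply/negbTE/negP => /g'_sub/g_sub.
  by move/(energy_coord (block_irr Eb) (Ordinal (ltnW r_gt1))); rewrite eqxx.
have le' : arcs g' setT <= (turan (n ^ r) (theta a bb)).*2.
  rewrite leqNgt -cN; apply/negP => /(turan_theta a_gt1 bb_gt0 g'_sym g'_irr).
  by case=> u [v [qs [th sqs]]]; apply: free th sqs.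
have := block_arcs EbP (ltnW r_gt1); rewrite -/e.
move: arcW leg; rewrite cardsT arcg cN mulnDl; lia.
Qed.

Lemma core_large : h * t ^ r <= (turan (n ^ r) (theta a (r * a * b).+1)).*2
  + ((r * ell).+1.*2 + 0) * n ^ r.
Proof.
apply: core_bound => // V B J lb cJ lb_sym lb_irr lb_fun lb_inj g g_sym g_sub g_deg ns.
exists g; split; rewrite ?addn0 // => u v qs th sqs.
by apply: (no_large_theta lb_sym lb_irr lb_fun lb_inj cJ r_gt1 ltra b_gt1
  g_sym g_sub g_deg ns th); rewrite sqs.
Qed.

Lemma core_cycle : b = 2 -> h * t ^ r <= (turan (n ^ r) (theta a b)).*2
  + ((r * ell).+1.*2 + 0) * n ^ r.
Proof.
move=> b2; apply: core_bound; first exact: ltnW.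
move=> V B J lb cJ lb_sym lb_irr lb_fun lb_inj g g_sym g_sub g_deg ns.
exists g; split; rewrite ?addn0 // => u v qs th sqs.
exact: (no_short_cycle lb_sym lb_irr lb_fun lb_inj cJ r_gt1 ltra b_gt1
  g_sym g_sub g_deg ns b2 th sqs).
Qed.

Lemma core_many : a * a * ((2 * a + 2) * a) ^ 2 < b ->
  h * t ^ r <= (turan (n ^ r) (theta a b)).*2
  + ((r * ell).+1.*2 + (r * ell).*2) * n ^ r.
Proof.
move=> b_large; apply: core_bound; first exact: ltnW.
move=> V B J lb cJ lb_sym lb_irr lb_fun lb_inj g g_sym g_sub g_deg ns.
have [g' [? ? le1 ?]] := sparse_deletion lb_sym lb_irr lb_fun lb_inj cJ r_gt1 ltra
  b_gt1 g_sym g_sub g_deg ns b_large.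
by exists g'; split => //; rewrite -doubleMl.
Qed.

End Core.

Lemma pq_number_colorable n p q : 0 < q <= 'C(p, 2) ->
  pq_colorable n p q (pq_number n p q).
Proof.
case/andP => q_gt0 leq_; have ex : exists k, pq_colorable n p q k.
  exists #|{: edge 'I_n}|; apply/existsP; exists [ffun e => enum_rank e].
  apply/forallP => S; apply/implyP => /eqP cS.
  rewrite card_imset; last by move=> e f; rewrite !ffunE => /enum_rank_inj.
  by rewrite card_edges_in cS.
rewrite /pq_number; case: boolp.pselect => // h; by case: ex_minnP.
Qed.

(** Each of [t] and [h] is chosen so that one summand of the budget is about half of the [m] edges.
    Then [m ^ r] is split into one factor [m <= 4r * ht] and [r - 1] factors [m <= 8prk * t]. If [t]
    rounds to zero, [k] is already of order [n ^ 2]. *)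
Lemma block_sizes n k p r : 1 < n -> 0 < k -> 0 < p -> 1 < r ->
  n ^ 2 <= 16 * p * r * k \/
  exists h t, [/\ 0 < t, h * (r * t) + k * (2 * p * (r * t)) <= 'C(n, 2) &
    n ^ (2 * r) <= 4 ^ r * (4 * r) * (8 * p * r) ^ r.-1 * k ^ r.-1 * (h * t ^ r)].
Proof.
move=> n_gt1 k_gt0 p_gt0 r_gt1.
set m := 'C(n, 2).
have lem : n ^ 2 <= 4 * m.
  have e1 : n * n.-1 = 2 * m by rewrite -[n.-1]bin1 mul_bin_diag.
  have : n * n <= n * (2 * n.-1) by rewrite leq_mul2l; lia.
  by rewrite -mulnn; lia.
pose t := m %/ (4 * k * p * r).
have [t0|t_gt0] := posnP t.
  left; have : m < 4 * k * p * r.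
    have d_gt0 : 0 < 4 * k * p * r by rewrite !muln_gt0 k_gt0 p_gt0 (ltnW r_gt1).
    by rewrite ltnNge -(divn_gt0 _ d_gt0) -/t t0.
  by move: lem; lia.
right; pose h := m %/ (2 * r * t); exists h, t; split => //.
  have h1 : h * (2 * r * t) <= m by apply: leq_trunc_div.
  have h2 : t * (4 * k * p * r) <= m by apply: leq_trunc_div.
  have -> : k * (2 * p * (r * t)) = 2 * (t * (k * p * r)) by lia.
  have e1 : h * (2 * r * t) = 2 * (h * (r * t)) by lia.
  have e2 : t * (4 * k * p * r) = 4 * (t * (k * p * r)) by lia.
  by move: h1 h2; rewrite e1 e2; lia.
have lt_m1 : m <= t * (8 * p * r * k).
  have : m < t.+1 * (4 * k * p * r).
    by apply: ltn_ceil; rewrite !muln_gt0 k_gt0 p_gt0 (ltnW r_gt1).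
  have e1 : t.+1 * (4 * k * p * r) = t * (4 * (k * p * r)) + 4 * (k * p * r) by lia.
  have e2 : t * (8 * p * r * k) = t * (4 * (k * p * r)) + t * (4 * (k * p * r)) by lia.
  have : 4 * (k * p * r) <= t * (4 * (k * p * r)) by apply: leq_pmull.
  by rewrite e1 e2; lia.
have lt_m2 : m <= 4 * r * (h * t).
  have le2rt : 2 * r * t <= m.
    apply: leq_trans (leq_trunc_div m (4 * k * p * r)); rewrite -/t mulnC leq_mul2l.
    apply/orP; right; rewrite leq_mul2r; apply/orP; right.
    by rewrite -mulnA; apply: (@leq_trans (4 * 1)) => //; rewrite leq_mul2l muln_gt0 k_gt0.
  have h_gt0 : 0 < h by rewrite divn_gt0 ?muln_gt0 ?t_gt0 ?(ltnW r_gt1).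
  have : m < h.+1 * (2 * r * t) by apply: ltn_ceil; rewrite !muln_gt0 t_gt0 (ltnW r_gt1).
  have : 2 * r * t <= h * (2 * r * t) by apply: leq_pmull.
  have -> : 4 * r * (h * t) = h * (2 * r * t) + h * (2 * r * t) by lia.
  by rewrite mulSn; lia.
have key : m ^ r <= 4 * r * (h * t) * (t * (8 * p * r * k)) ^ r.-1.
  rewrite -{1}(prednK (ltnW r_gt1)) expnS; apply: leq_mul => //.
  by rewrite leq_exp2r //; lia.
have -> : 4 ^ r * (4 * r) * (8 * p * r) ^ r.-1 * k ^ r.-1 * (h * t ^ r) =
          4 ^ r * (4 * r * (h * t) * (t * (8 * p * r * k)) ^ r.-1).
  have -> : t ^ r = t * t ^ r.-1 by rewrite -expnS prednK // ltnW.
  by rewrite !(expnMn t) !(expnMn (8 * p * r)); lia.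
rewrite expnM; apply: (@leq_trans ((4 * m) ^ r)).
  by rewrite leq_exp2r // ltnW.
by rewrite expnMn leq_mul2l key orbT.
Qed.

From mathcomp Require Import all_classical all_reals all_analysis lra.

Import Order.TTheory GRing.Theory Num.Theory.
Import numFieldNormedType.Exports.

Local Open Scope ring_scope.
Local Open Scope classical_set_scope.

(** * Asymptotics *)

Section Asymptotics.
Variable R : realType.

Lemma bigO_natP (f g : nat -> R) :
  (f : nat -> R^o) =O_\oo (g : nat -> R^o) <->
  exists C N, 0 < C /\ forall n, (N <= n)%N -> `|f n| <= C * `|g n|.
Proof.
split=> [/eqO_exP[C C0 [N _ H]]|[C [N [C0 H]]]]; first by exists C, N.
by apply/eqO_exP; exists C => //; exists N.
Qed.

Lemma bigOmega_nat (f g : nat -> R) c N : 0 < c ->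
  (forall n, (N <= n)%N -> c * `|g n| <= `|f n|) ->
  (f : nat -> R^o) =Omega_\oo (g : nat -> R^o).
Proof.
move=> c0 H; rewrite eqOmegaE qualifE; apply/asboolP; exists c => //.
by exists N.
Qed.

Lemma turan_theta_bigO a b : (1 < a)%N ->
  (fun n => (turan n (theta a b))%:R : R^o) =O_\oo
  (fun n => n%:R `^ (2 - (1 - a%:R^-1)) : R^o).
Proof.
move=> a_gt1; have [C CP] := turan_theta_upper b a_gt1.
have a0 : a%:R != 0 :> R by rewrite pnatr_eq0 -lt0n ltnW.
apply/bigO_natP; exists ((C.+1)%:R `^ a%:R^-1), 0%N; split; first by rewrite powR_gt0.
move=> n _; rewrite ger0_norm // ger0_norm ?powR_ge0 //.
have -> : 2 - (1 - a%:R^-1) = a.+1%:R / a%:R :> R.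
  by rewrite -[a.+1%:R]natr1 mulrDl mulfV // mul1r; lra.
have -> : (turan n (theta a b))%:R = ((turan n (theta a b))%:R ^+ a) `^ a%:R^-1 :> R.
  by rewrite -powR_mulrn // -powRrM mulfV // powRr1.
rewrite powRrM powR_mulrn // -powRM ?exprn_ge0 //.
apply: ge0_ler_powR; rewrite ?nnegrE ?invr_ge0 ?exprn_ge0 ?mulr_ge0 ?exprn_ge0 //.
rewrite -!natrX -natrM ler_nat; apply: leq_trans (CP n) _.
by rewrite leq_mul2r leqnSn orbT.
Qed.

Lemma turan_theta_exponent (alpha : R) a b : (2 < a)%N -> (0 < b)%N ->
  (fun n => (turan n (theta a b))%:R : R^o) =O_\oo
    (fun n => n%:R `^ (2 - alpha) : R^o) -> alpha <= 1.
Proof.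
move=> a_gt2 b_gt0 /bigO_natP[C [N [C0 H]]]; rewrite leNgt; apply/negP => al.
(* The star gives [n / 2 <= C * n ^ (2 - alpha)], that is, [n ^ (alpha - 1) <= 2 * C < M], which
   fails for the [n] below. *)
pose M := 2 * C + 1; have M0 : 0 < M by rewrite /M; lra.
pose n := (maxn 2 (maxn N (Num.truncn (M `^ (alpha - 1)^-1)).+1))%N.
have n2 : (2 <= n)%N by rewrite leq_maxl.
have nN : (N <= n)%N by rewrite /n maxnCA leq_maxl.
have nM : M `^ (alpha - 1)^-1 <= n%:R.
  apply: ltW; apply: lt_le_trans (truncnS_gt _) _.
  by rewrite ler_nat /n !leq_max leqnn !orbT.
have n0 : 0 < n%:R :> R by rewrite ltr0n ltnW.
have := H n nN; rewrite ger0_norm // ger0_norm ?powR_ge0 // => Hn.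
have le1 : n%:R / 2 <= C * n%:R `^ (2 - alpha).
  apply: le_trans Hn; apply: (@le_trans _ _ n.-1%:R).
    rewrite ler_pdivrMr // -natrM ler_nat; move: n2; clear.
    by case: n => [|[|n]] //= _; rewrite muln2 -addnn addSnnS leq_addl.
  by rewrite ler_nat turan_theta_star.
have eq1 : n%:R = n%:R `^ (2 - alpha) * n%:R `^ (alpha - 1) :> R.
  rewrite -powRD; last by rewrite (gt_eqF n0) implybT.
  by rewrite (_ : 2 - alpha + (alpha - 1) = 1) ?powRr1 //; lra.
have le2 : M <= n%:R `^ (alpha - 1).
  have al0 : alpha - 1 != 0 by rewrite gt_eqF // subr_gt0.
  rewrite -[X in X <= _](powRr1 (ltW M0)) -[X in M `^ X](mulVf al0) powRrM.
  by apply: ge0_ler_powR; rewrite ?nnegrE ?powR_ge0 // subr_ge0 ltW.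
have y0 : 0 < n%:R `^ (2 - alpha) :> R by rewrite powR_gt0.
rewrite {1}eq1 in le1; move: le1 le2 y0.
move: (n%:R `^ (2 - alpha)) (n%:R `^ (alpha - 1)) => y z le1 le2 y0.
have : y * z <= y * (2 * C) by lra.
by rewrite ler_pM2l // => ?; move: le2; rewrite /M; lra.
Qed.

(** By [alpha <= 1] the term [K * n ^ r] is absorbed, and the second alternative reads [n ^ (2r) =
    O(k ^ (r - 1) * n ^ (r(2 - alpha)))]. The first one suffices because
    [alpha * r / (r - 1) <= 2]. *)
Lemma coloring_growth (alpha C : R) (r p K A N0 : nat) (T : nat -> nat) :
    0 < alpha <= 1 -> (1 < r)%N -> 0 < C ->
    (forall n, (N0 <= n)%N -> (T n)%:R <= C * n%:R `^ (2 - alpha)) ->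
  exists2 c : R, 0 < c & forall n k, (N0 <= n)%N -> (0 < n)%N ->
    (n ^ 2 <= 16 * p * r * k)%N \/
    (n ^ (2 * r) <= A * k ^ r.-1 * ((T (n ^ r)).*2 + K * n ^ r))%N ->
  c * n%:R `^ (alpha * r%:R / (r%:R - 1)) <= k%:R.
Proof.
move=> /andP[al0 al1] r_gt1 C0 TC.
have r1 : 0 < r%:R - 1 :> R by rewrite subr_gt0 ltr1n.
have r1E : r.-1%:R = r%:R - 1 :> R by rewrite -subn1 natrB // ltnW.
pose D : R := A%:R * (2 * C + K%:R) + 1.
have D0 : 0 < D.
  by rewrite ltr_wpDl // mulr_ge0 // addr_ge0 // mulr_ge0 // ltW.
pose E := (16 * p * r)%:R + D `^ (r%:R - 1)^-1.
have E0 : 0 < E by rewrite ltr_wpDl // powR_gt0.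
exists E^-1 => [|n k leN n_gt0 bound]; first by rewrite invr_gt0.
rewrite ler_pdivrMl //; set x : R := n%:R; set be := alpha * r%:R / (r%:R - 1).
have x1 : 1 <= x by rewrite ler1n.
have x0 : 0 < x by apply: lt_le_trans x1.
case: bound => bound.
  apply: (@le_trans _ _ (x `^ 2%:R)).
    apply: ler_powR => //; rewrite /be ler_pdivrMr //.
    have : 2 <= r%:R :> R by rewrite ler_nat.
    by move=> r2; have := ler_wpM2r (ler0n R r) al1; lra.
  rewrite powR_mulrn ?(ltW x0) // -natrX.
  apply: (@le_trans _ _ ((16 * p * r)%:R * k%:R)); first by rewrite -natrM ler_nat.
  by apply: ler_wpM2r => //; rewrite lerDl powR_ge0.
have Xr : (n ^ r)%:R = x `^ r%:R by rewrite natrX powR_mulrn // ltW.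
pose y := x `^ (r%:R * (2 - alpha)).
have y0 : 0 < y by rewrite powR_gt0.
have Ty : (T (n ^ r)%N)%:R <= C * y.
  have leN' : (N0 <= n ^ r)%N.
    apply: leq_trans leN _; rewrite -{1}[n]expn1; apply: leq_pexp2l => //; exact: ltnW.
  by apply: le_trans (TC _ leN') _; rewrite Xr -powRrM.
have Ky : (n ^ r)%:R <= y.
  by rewrite Xr; apply: ler_powR => //; rewrite ler_peMr //; lra.
have main : y * x `^ (r%:R * alpha) <= y * (D * k%:R ^+ r.-1).
  have -> : y * x `^ (r%:R * alpha) = (n ^ (2 * r))%:R.
    rewrite -powRD; last by rewrite (gt_eqF x0) implybT.
    rewrite natrX -powR_mulrn ?(ltW x0) // -/x natrM; congr (_ `^ _); lra.
  apply: (@le_trans _ _ (A%:R * k%:R ^+ r.-1 * ((2 * C + K%:R) * y))).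
    rewrite -(ler_nat R) in bound; apply: le_trans bound _.
    rewrite natrM natrM natrX; apply: ler_wpM2l; first by rewrite mulr_ge0 ?exprn_ge0.
    rewrite natrD -mul2n !natrM; have := ler_wpM2l (ler0n R K) Ky.
    by move: Ty; lra.
  have k0 : 0 <= k%:R ^+ r.-1 :> R by rewrite exprn_ge0.
  have -> : A%:R * k%:R ^+ r.-1 * ((2 * C + K%:R) * y) =
     y * (A%:R * (2 * C + K%:R) * k%:R ^+ r.-1) by rewrite mulrCA mulrC; lra.
  by rewrite ler_pM2l // ler_wpM2r // lerDl.
rewrite ler_pM2l // in main.
apply: (@le_trans _ _ (D `^ (r%:R - 1)^-1 * k%:R)); last first.
  by apply: ler_wpM2r => //; rewrite lerDr.
have -> : x `^ be = (x `^ (r%:R * alpha)) `^ (r%:R - 1)^-1.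
  by rewrite -powRrM /be (mulrC alpha).
have -> : k%:R = (k%:R ^+ r.-1) `^ (r%:R - 1)^-1 :> R.
  by rewrite -powR_mulrn // -powRrM r1E mulfV ?gt_eqF // powRr1.
rewrite -powRM ?exprn_ge0 //; last exact: ltW.
apply: ge0_ler_powR; rewrite ?nnegrE ?powR_ge0 ?invr_ge0 //; first exact: ltW.
by rewrite mulr_ge0 ?exprn_ge0 // ltW.
Qed.

(** The Turan number may be that of a theta graph with another number [bb] of legs, as the case of
    arbitrary [b] requires. *)
Lemma theta_bigOmega (alpha : R) a b r bb K : 0 < alpha <= 1 ->
    (1 < r)%N -> (r < a)%N -> (1 < b)%N ->
    (fun n => (turan n (theta a bb))%:R : R^o) =O_\oo
      (fun n => n%:R `^ (2 - alpha) : R^o) ->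
    (forall n k h t (c : {ffun edge 'I_n -> 'I_k}), (0 < t)%N ->
      (r * (2 + b * a.-1) <= n)%N ->
      pq_coloring (r * (2 + b * a.-1))
        ('C(r * (2 + b * a.-1), 2) - r.-1 * (a * b) + 1) c ->
      (h * (r * t) + k * (2 * (r * (2 + b * a.-1)) * (r * t)) <= 'C(n, 2))%N ->
      (h * t ^ r <= (turan (n ^ r) (theta a bb)).*2 + K * n ^ r)%N) ->
  (fun n => (pq_number n (r * #|theta_vertex a b|)
      ('C(r * #|theta_vertex a b|, 2) - (r - 1) * #|theta a b| + 1))%:R : R^o)
    =Omega_\oo
  (fun n => n%:R `^ (alpha * r%:R / (r%:R - 1)) : R^o).
Proof.
move=> al r_gt1 ltra b_gt1 /bigO_natP[C [N0 [C0 TC]]] core.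
have a_gt1 : (1 < a)%N := ltn_trans r_gt1 ltra.
rewrite card_theta // card_theta_vertex !subn1.
set p := (r * (2 + b * a.-1))%N in core *.
set q := ('C(p, 2) - r.-1 * (a * b) + 1)%N in core *.
have p_gt1 : (1 < p)%N by rewrite (leq_trans r_gt1) // leq_pmulr.
have qP : (0 < q <= 'C(p, 2))%N.
  have X0 : (0 < r.-1 * (a * b))%N.
    by rewrite !muln_gt0 -ltnS prednK ?r_gt1 ?(ltnW a_gt1) ?(ltnW b_gt1) // ltnW.
  have Cp : (0 < 'C(p, 2))%N by rewrite bin_gt0.
  rewrite /q addn1 /=; move: X0 Cp; case: (r.-1 * (a * b))%N => // x _.
  by case: 'C(p, 2)%N => // y _; rewrite subSS ltnS leq_subr.
have TC' n : (N0 <= n)%N -> (turan n (theta a bb))%:R <= C * n%:R `^ (2 - alpha).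
  by move/TC; rewrite ger0_norm // ger0_norm // powR_ge0.
have [c c0 grow] := coloring_growth p K (4 ^ r * (4 * r) * (8 * p * r) ^ r.-1)
  al r_gt1 C0 TC'.
apply: (@bigOmega_nat _ _ c (maxn N0 (maxn 2 p))) => // n.
rewrite !geq_max => /and3P[leN n_gt1 lepn].
rewrite ger0_norm ?powR_ge0 // ger0_norm //.
have /existsP[col colP] := pq_number_colorable n qP.
set k := pq_number n p q in col colP *.
have k_gt0 : (0 < k)%N.
  have e2 : #|[set Ordinal (ltnW n_gt1); Ordinal n_gt1]%SET| == 2%N by rewrite cards2.
  by case: (col (mk_edge e2)) => m; apply: leq_ltn_trans.
apply: grow => //; first exact: ltnW.
case: (block_sizes n_gt1 k_gt0 (ltnW p_gt1) r_gt1) => [|[h [t [t_gt0 fits big]]]].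
  by left.
right; apply: leq_trans big _; rewrite leq_mul2l; apply/orP; right.
exact: core t_gt0 lepn colP fits.
Qed.

End Asymptotics.

Theorem theorem4p1 (R : realType) (a : nat) :
  exists b0 : nat, forall r : nat, (2 <= r)%N -> (r < a)%N ->
    [/\ forall b : nat, (2 <= b)%N -> nice_at r (1 - a%:R^-1 : R) (theta a b),
        forall b : nat, (2 <= b)%N -> b = 2%N \/ (b0 <= b)%N ->
          nice R r (theta a b)
      & forall b : nat, (2 <= b)%N ->
          let l := (2 + b * (a - 1))%N in
          l = #|theta_vertex a b| /\
          (fun n => (pq_number n (r * l) ('C(r * l, 2) - (r - 1) * (a * b) + 1))%:R
             : R^o)
            =Omega_\oo
          (fun n => n%:R `^ (r%:R / (r%:R - 1) * ((a%:R - 1) / a%:R)) : R^o)].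
Proof.
exists (a * a * ((2 * a + 2) * a) ^ 2).+1%N => r r_gt1 ltra.
have a_gt1 : (1 < a)%N := ltn_trans r_gt1 ltra.
have a_gt2 : (2 < a)%N := leq_ltn_trans r_gt1 ltra.
have a0 : 0 < a%:R :> R by rewrite ltr0n ltnW.
have al : 0 < (1 - a%:R^-1 : R) <= 1.
  by rewrite subr_gt0 invf_lt1 // ltr1n a_gt1 gerBl invr_ge0 ltW.
have nice1 b : (2 <= b)%N -> nice_at r (1 - a%:R^-1 : R) (theta a b).
  move=> b_gt1; split => //.
  - exact: bipartite_theta.
  - by case/andP: al.
  - exact: turan_theta_bigO.
  (* Here [bb] becomes [(r * a * b).+1]; the upper bound has the same exponent for every number of
     legs. *)
  apply: theta_bigOmega (turan_theta_bigO R _ a_gt1) _ => //.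
  by move=> n k h t c t_gt0 le_n cP fits; apply: (core_large _ _ _ t_gt0 le_n cP fits).
split=> // b b_gt1.
- move=> b_cases; split => //; first exact: bipartite_theta.
  move=> alpha al0 Oal.
  have al1 : alpha <= 1 by apply: turan_theta_exponent Oal; rewrite // ltnW.
  split=> //; first exact: bipartite_theta.
  case: b_cases => [b2|b_large].
    apply: theta_bigOmega Oal _; rewrite ?al0 //.
    move=> n k h t c t_gt0 le_n cP fits.
    exact: (core_cycle _ _ _ t_gt0 le_n cP fits b2).
  apply: theta_bigOmega Oal _; rewrite ?al0 //.
  move=> n k h t c t_gt0 le_n cP fits.
  exact: (core_many _ _ _ t_gt0 le_n cP fits b_large).
move=> l; rewrite card_theta_vertex; split=> //.
have [_ _ _ _] := nice1 b b_gt1.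
rewrite card_theta // card_theta_vertex.
have -> // : (1 - a%:R^-1) * r%:R / (r%:R - 1) =
    r%:R / (r%:R - 1) * ((a%:R - 1) / a%:R) :> R.
by rewrite (mulrBl a%:R^-1) mulfV ?gt_eqF // mul1r -mulrA mulrC.
Qed.
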